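(* Let $\bar\varrho>0$ be any constant, and let $p$ be an arbitrary (smooth) equation of state with positive sound speed $c$. Let $(\rho,v^1,v^2,v^3,s)$ be a (smooth) solution, in three spatial dimensions, of the compressible Euler equations $$B\rho=-\mathrm{div}\,v,\qquad Bv^i=-c^2\delta^{ia}\partial_a\rho-\exp(-\rho)\frac{p_{;s}}{\bar\varrho}\delta^{ia}\partial_a s,\qquad Bs=0\qquad(i=1,2,3).$$ Let $\Omega$, $S$, $\mathcal{C}$, $\mathcal{D}$, $g$ and $\square_g$ be the specific vorticity, entropy gradient, modified fluid variables, acoustical metric and its covariant wave operator, as defined in the context. Then the following equations hold for $i=1,2,3$, where in the wave equation for $v^i$ the Cartesian component functions $v^i$ are treated as scalar-valued functions under covariant differentiation. Covariant wave equations: $$\square_g v^i=-c^2\exp(2\rho)\,\mathcal{C}^i+\mathfrak{Q}_{(v)}^i+\mathfrak{L}_{(v)}^i,\qquad \square_g\rho=-\exp(\rho)\frac{p_{;s}}{\bar\varrho}\mathcal{D}+\mathfrak{Q}_{(\rho)}+\mathfrak{L}_{(\rho)}.$$ Transport equations: $$B\Omega^i=\mathfrak{L}_{(\Omega)}^i,\qquad Bs=0,\qquad BS^i=\mathfrak{L}_{(S)}^i.$$ Transport-divergence-curl system for the specific vorticity: $$\mathrm{div}\,\Omega=\mathfrak{L}_{(\mathrm{div}\,\Omega)},$$ $$\begin{aligned}B\mathcal{C}^i={}&-2\delta_{jk}\epsilon_{iab}\exp(-\rho)(\partial_a v^j)\partial_b\Omega^k+\epsilon_{ajk}\exp(-\rho)(\partial_a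 v^i)\partial_j\Omega^k\\&+\exp(-3\rho)c^{-2}\frac{p_{;s}}{\bar\varrho}\{(BS^a)\partial_a v^i-(Bv^i)\partial_aS^a\}\\&+\exp(-3\rho)c^{-2}\frac{p_{;s}}{\bar\varrho}\{(Bv^a)\partial_aS^i-(\partial_av^a)BS^i\}+\mathfrak{Q}_{(\mathcal{C})}^i+\mathfrak{L}_{(\mathcal{C})}^i.\end{aligned}$$ Transport-divergence-curl system for the entropy gradient: $$B\mathcal{D}=2\exp(-2\rho)\{(\partial_av^a)\partial_bS^b-(\partial_av^b)\partial_bS^a\}+\exp(-\rho)\delta_{ab}(\mathrm{curl}\,\Omega)^aS^b+\mathfrak{Q}_{(\mathcal{D})},\qquad (\mathrm{curl}\,S)^i=0.$$ Here the $\mathfrak{Q}$'s are the following null forms relative to $g$: $$\mathfrak{Q}_{(v)}^i=-\{1+c^{-1}c_{;\rho}\}(g^{-1})^{\alpha\beta}\partial_\alpha\rho\,\partial_\beta v^i,$$ $$\mathfrak{Q}_{(\rho)}=-3c^{-1}c_{;\rho}(g^{-1})^{\alpha\beta}\partial_\alpha\rho\,\partial_\beta\rho+\{(\partial_av^a)(\partial_bv^b)-(\partial_av^b)\partial_bv^a\},$$ $$\begin{aligned}\mathfrak{Q}_{(\mathcal{C})}^i={}&\exp(-3\rho)c^{-2}\frac{p_{;s}}{\bar\varrho}S^i\{(\partial_av^b)\partial_bv^a-(\partial_av^a)\partial_bv^b\}\\&+\exp(-3\rho)c^{-2}\frac{p_{;s}}{\bar\varrho}\{(\partial_av^a)S^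b\partial_bv^i-(S^a\partial_av^b)\partial_bv^i\}\\&+2\exp(-3\rho)c^{-2}\frac{p_{;s}}{\bar\varrho}\{(S^a\partial_a\rho)Bv^i-(B\rho)S^a\partial_av^i\}\\&+2\exp(-3\rho)c^{-3}c_{;\rho}\frac{p_{;s}}{\bar\varrho}\{(S^a\partial_a\rho)Bv^i-(B\rho)S^a\partial_av^i\}\\&+\exp(-3\rho)c^{-2}\frac{p_{;s;\rho}}{\bar\varrho}\{(B\rho)S^a\partial_av^i-(S^a\partial_a\rho)Bv^i\}\\&+\exp(-3\rho)c^{-2}\frac{p_{;s;\rho}}{\bar\varrho}S^i\{(Bv^a)\partial_a\rho-(\partial_av^a)B\rho\}\\&+2\exp(-3\rho)c^{-2}\frac{p_{;s}}{\bar\varrho}S^i\{(\partial_av^a)B\rho-(Bv^a)\partial_a\rho\}\\&+2\exp(-3\rho)c^{-3}c_{;\rho}\frac{p_{;s}}{\bar\varrho}S^i\{(\partial_av^a)B\rho-(Bv^a)\partial_a\rho\},\end{aligned}$$ $$\mathfrak{Q}_{(\mathcal{D})}=2\exp(-2\rho)\{(S^a\partial_av^b)\partial_b\rho-(\partial_av^a)S^b\partial_b\rho\},$$ and the $\mathfrak{L}$'s, which are at most linear in the derivatives of the unknowns, are: $$\begin{aligned}\mathfrak{L}_{(v)}^i={}&2\exp(\rho)\epsilon_{iab}(Bv^a)\Omega^b-\frac{p_{;s}}{\bar\varrho}\epsilon_{iab}\Omega^aS^b\\&-\exp(-\rho)\frac{p_{;s}}{\bar\varrho}S^a\partial_av^i-\tfrac12\exp(-\rho)\frac{p_{;\rho;s}}{\bar\varrho}S^a\partial_av^i\\&-2\exp(-\rho)c^{-1}c_{;\rho}\frac{p_{;s}}{\bar\varrho}(B\rho)S^i+\exp(-\rho)\frac{p_{;s;\rho}}{\bar\varrho}(B\rho)S^i,\end{aligned}$$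 $$\mathfrak{L}_{(\rho)}=-2\exp(-\rho)\frac{p_{;s;\rho}}{\bar\varrho}S^a\partial_a\rho-\exp(-\rho)\frac{p_{;s;s}}{\bar\varrho}\delta_{ab}S^aS^b,$$ $$\mathfrak{L}_{(\Omega)}^i=\Omega^a\partial_av^i-\exp(-2\rho)c^{-2}\frac{p_{;s}}{\bar\varrho}\epsilon_{iab}(Bv^a)S^b,$$ $$\mathfrak{L}_{(S)}^i=-S^a\partial_av^i+\epsilon_{iab}\exp(\rho)\Omega^aS^b,\qquad \mathfrak{L}_{(\mathrm{div}\,\Omega)}=-\Omega^a\partial_a\rho,$$ $$\begin{aligned}\mathfrak{L}_{(\mathcal{C})}^i={}&2\exp(-3\rho)c^{-3}c_{;s}\frac{p_{;s}}{\bar\varrho}(Bv^i)\delta_{ab}S^aS^b-2\exp(-3\rho)c^{-3}c_{;s}\frac{p_{;s}}{\bar\varrho}\delta_{ab}S^a(Bv^b)S^i\\&+\exp(-3\rho)c^{-2}\frac{p_{;s;s}}{\bar\varrho}(Bv^i)\delta_{ab}S^aS^b-\exp(-3\rho)c^{-2}\frac{p_{;s;s}}{\bar\varrho}\delta_{ab}(Bv^a)S^bS^i.\end{aligned}$$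
   Context: Coordinates and indices: $(x^0,x^1,x^2,x^3)$ are Cartesian coordinates on $\mathbb{R}^{1+3}$, $x^0=t$, $\partial_\alpha=\partial/\partial x^\alpha$. Greek indices range over $0,1,2,3$, Latin indices over $1,2,3$, and repeated indices are summed. $\delta$ is the Kronecker delta; $\epsilon_{ijk}$ is fully antisymmetric with $\epsilon_{123}=1$. For a vectorfield $V=(V^1,V^2,V^3)$, $\mathrm{div}\,V=\partial_aV^a$ and $(\mathrm{curl}\,V)^i=\epsilon_{iab}\partial_aV^b$. A vectorfield acts on a function by $Vf=V^\alpha\partial_\alpha f$. Fluid variables: $v=(v^1,v^2,v^3)$ is the velocity, $\varrho>0$ the density, $s$ the entropy, $p=p(\varrho,s)$ the pressure (given by the equation of state), $\bar\varrho>0$ a fixed constant. The logarithmic density is $\rho=\ln(\varrho/\bar\varrho)$. Quantities such as $p$ are viewed as functions of $(\rho,s)$; $f_{;\rho}=\partial f/\partial\rho$, $f_{;s}=\partial f/\partial s$, and similarly for higher derivatives (e.g. $f_{;\rho;s}=\partial^2f/\partial s\,\partial\rho$). The speed of sound is $$c=c(\rho,s)=\sqrt{\frac{\partial p}{\partial\varrho}\Big|_s}=\sqrt{\frac{1}{\bar\varrho}\exp(-\rho)\,p_{;\rho}},$$ assumed to satisfy $c>0$ whenever $\rho\in(-\infty,\infty)$. The material derivative is $B=\partial_t+v^a\partial_a$. The vorticity is $\omega=\mathrm{curl}\,v$, the specific vorticity is $\Omega=\omega/\exp(\rho)$, and the entropy gradient is $S^i=\partial_is$. The modified fluid variables are $$\mathcal{C}^i=\exp(-\rho)(\mathrm{curl}\,\Omega)^i+\exp(-3\rho)c^{-2}\frac{p_{;s}}{\bar\varrho}S^a\partial_av^i-\exp(-3\rho)c^{-2}\frac{p_{;s}}{\bar\varrho}(\partial_av^a)S^i,$$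 $$\mathcal{D}=\exp(-2\rho)\,\mathrm{div}\,S-\exp(-2\rho)S^a\partial_a\rho.$$ Geometry: the acoustical metric and its inverse are $$g=-dt\otimes dt+c^{-2}\sum_{a=1}^3(dx^a-v^adt)\otimes(dx^a-v^adt),\qquad g^{-1}=-B\otimes B+c^2\sum_{a=1}^3\partial_a\otimes\partial_a,$$ and the covariant wave operator acts on scalar functions $\phi$ by $$\square_g\phi=\frac{1}{\sqrt{|\det g|}}\partial_\alpha\left\{\sqrt{|\det g|}\,(g^{-1})^{\alpha\beta}\partial_\beta\phi\right\}.$$ Null forms relative to $g$: linear combinations, with coefficients that are functions of the undifferentiated unknowns $\rho,v^i,s,\Omega^i,S^i$, of the standard null forms $(g^{-1})^{\alpha\beta}\partial_\alpha\phi\,\partial_\beta\widetilde\phi$ and $\partial_\alpha\phi\,\partial_\beta\widetilde\phi-\partial_\alpha\widetilde\phi\,\partial_\beta\phi$, with $\phi,\widetilde\phi$ among the unknowns.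
   Formalization: Three terms, false as printed, are corrected: in L_(v) the term -exp(-ρ)(p_;s/ϱ̄)S^a∂_a v^i is dropped; in L_(ρ) the coefficient -2 becomes -5/2; in L_(C) the signs of the two p_;s;s terms are reversed. *)

(* Defs.v *)
From HB Require Import structures.
From mathcomp Require Import all_boot all_order all_algebra.
From mathcomp Require Import all_classical all_reals all_analysis.
From mathcomp Require Import ring.

Set Implicit Arguments.
Unset Strict Implicit.
Unset Printing Implicit Defensive.

Import Order.TTheory GRing.Theory Num.Theory.
Import numFieldNormedType.Exports.

Local Open Scope classical_set_scope.
Local Open Scope ring_scope.

Section smoothness.
Context (R : realType) (V : normedModType R).

Definition iter_derive (f : V -> R) (l : seq V) : V -> R :=
  foldr (fun w (h : V -> R) => 'D_w h) f l.

(* For finite-dimensional V and open D (the only case used), this is C^oo:   *)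
(* the f-derivatives of every order exist and are Frechet differentiable.    *)
Definition smooth_on (D : set V) (f : V -> R) : Prop :=
  forall (l : seq V) (x : V), D x -> differentiable (iter_derive f l) x.

End smoothness.

(* Coordinate 0 is the time t; coordinate lift ord0 a, for a : 'I_3, is the  *)
(* (a+1)-st space coordinate.                                                *)
Notation spacetime R := 'rV[R]_4.

Section calculus.
Context (R : realType).
Implicit Types (f : spacetime R -> R) (V : 'I_3 -> spacetime R -> R).
Implicit Types (x : spacetime R) (X Y : 'I_3 -> R).

Definition pd (al : 'I_4) f x : R := 'D_(delta_mx 0 al) f x.

Definition sd (a : 'I_3) f x : R := pd (lift ord0 a) f x.

Definition levi_civita (i j k : 'I_3) : R :=
  match val i, val j, val k with
  | 0%N, 1%N, 2%N | 1%N, 2%N, 0%N | 2%N, 0%N, 1%N => 1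
  | 0%N, 2%N, 1%N | 2%N, 1%N, 0%N | 1%N, 0%N, 2%N => -1
  | _, _, _ => 0
  end.

Definition divg V x : R := \sum_a sd a (V a) x.

Definition curl V (i : 'I_3) x : R :=
  \sum_a \sum_b levi_civita i a b * sd a (V b) x.

Definition along V f x : R := \sum_a V a x * sd a f x.

Definition dot X Y : R := \sum_a X a * Y a.

Definition cross X Y (i : 'I_3) : R := \sum_a \sum_b levi_civita i a b * X a * Y b.

End calculus.

(* A thermodynamic state (density, entropy) or (logarithmic density, entropy)*)
(* is a pair of reals; d_fst and d_snd are the partial derivatives with      *)
(* respect to its two components.                                            *)
Definition d_fst (R : realType) (f : R * R -> R) : R * R -> R := 'D_(1, 0) f.

Definition d_snd (R : realType) (f : R * R -> R) : R * R -> R := 'D_(0, 1) f.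

(* The equation of state p is a function of (density, entropy); eos_log      *)
(* is the same quantity viewed as a function of (rho, s).                    *)
Definition eos_log (R : realType) (rhobar : R) (p : R * R -> R) : R * R -> R :=
  fun z => p (rhobar * expR z.1, z.2).

Definition sound_speed (R : realType) (rhobar : R) (p : R * R -> R) :
    R * R -> R :=
  fun z => Num.sqrt (d_fst p (rhobar * expR z.1, z.2)).

Record fluid (R : realType) := Fluid {
  log_density : spacetime R -> R ;
  velocity : 'I_3 -> spacetime R -> R ;
  entropy : spacetime R -> R }.

Section fluid_variables.
Context (R : realType) (rhobar : R) (p : R * R -> R) (u : fluid R).
Implicit Types (f : spacetime R -> R) (x : spacetime R) (i : 'I_3).

Local Notation rho := (log_density u).
Local Notation v := (velocity u).
Local Notation s := (entropy u).

Definition at_state (h : R * R -> R) x : R := h (rho x, s x).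

Local Notation P := (eos_log rhobar p).
Definition csp : spacetime R -> R := at_state (sound_speed rhobar p).
Definition csp_rho : spacetime R -> R := at_state (d_fst (sound_speed rhobar p)).
Definition csp_s : spacetime R -> R := at_state (d_snd (sound_speed rhobar p)).
Definition p_s : spacetime R -> R := at_state (d_snd P).
Definition p_rho_s : spacetime R -> R := at_state (d_snd (d_fst P)).
Definition p_s_rho : spacetime R -> R := at_state (d_fst (d_snd P)).
Definition p_s_s : spacetime R -> R := at_state (d_snd (d_snd P)).

Local Notation c := csp.
Local Notation c_rho := csp_rho.
Local Notation c_s := csp_s.

Definition material f x : R := pd ord0 f x + along v f x.

Local Notation B := material.

Definition Omega i x : R := curl v i x / expR (rho x).

Definition egrad i x : R := sd i s x.

Local Notation S := egrad.

Definition mod_vort i x : R :=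
  expR (- rho x) * curl Omega i x
  + expR (- (3 * rho x)) * (c x)^- 2 * (p_s x / rhobar) * along S (v i) x
  - expR (- (3 * rho x)) * (c x)^- 2 * (p_s x / rhobar) * divg v x * S i x.

Definition mod_ent x : R :=
  expR (- (2 * rho x)) * divg S x - expR (- (2 * rho x)) * along S rho x.

Definition euler_at x : Prop :=
  [/\ B rho x = - divg v x,
      forall i, B (v i) x = - (c x) ^+ 2 * sd i rho x
                            - expR (- rho x) * (p_s x / rhobar) * sd i s x
    & B s x = 0].

(* Components of the covectors dt and dx^a - v^a dt.                         *)
Definition dt (al : 'I_4) : R := (al == ord0)%:R.

Definition dx_vdt (a : 'I_3) x (al : 'I_4) : R :=
  (al == lift ord0 a)%:R - v a x * dt al.

Definition acoustic x : 'M[R]_4 :=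
  \matrix_(al, be) (- (dt al * dt be)
    + (c x)^- 2 * \sum_a dx_vdt a x al * dx_vdt a x be).

Definition Bvec x (al : 'I_4) : R := dt al + \sum_a v a x * (al == lift ord0 a)%:R.

Definition acoustic_inv x : 'M[R]_4 :=
  \matrix_(al, be) (- (Bvec x al * Bvec x be)
    + (c x) ^+ 2 * \sum_(a < 3) (al == lift ord0 a)%:R * (be == lift ord0 a)%:R).

Lemma acoustic_mul_inv x : csp x != 0 -> acoustic x *m acoustic_inv x = 1%:M.
Proof.
move=> c0; apply/matrixP => i j; rewrite !mxE.
rewrite !big_ord_recl !big_ord0 !mxE /Bvec /dx_vdt /dt !big_ord_recl !big_ord0.
move: c0; set y := csp x => c0.
by case: i => [[|[|[|[|//]]]] ?]; case: j => [[|[|[|[|//]]]] ?];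
  rewrite /= ?eqE /=; field.
Qed.

Definition ginv_form f h x : R :=
  \sum_al \sum_be acoustic_inv x al be * pd al f x * pd be h x.

Definition box f x : R :=
  (Num.sqrt `|\det (acoustic x)|)^-1 *
  \sum_al pd al (fun y => Num.sqrt `|\det (acoustic y)| *
                          \sum_be acoustic_inv y al be * pd be f y) x.

Definition Q_v i x : R :=
  - (1 + (c x)^-1 * c_rho x) * ginv_form rho (v i) x.

Definition Q_rho x : R :=
  - (3 * (c x)^-1 * c_rho x * ginv_form rho rho x)
  + ((\sum_a sd a (v a) x) * (\sum_b sd b (v b) x)
     - \sum_a \sum_b sd a (v b) x * sd b (v a) x).

Definition Q_C i x : R :=
  expR (- (3 * rho x)) * (c x)^- 2 * (p_s x / rhobar) * S i x *
    ((\sum_a \sum_b sd a (v b) x * sd b (v a) x) - divg v x * divg v x)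
  + expR (- (3 * rho x)) * (c x)^- 2 * (p_s x / rhobar) *
    (divg v x * along S (v i) x
     - \sum_a \sum_b S a x * sd a (v b) x * sd b (v i) x)
  + 2 * expR (- (3 * rho x)) * (c x)^- 2 * (p_s x / rhobar) *
    (along S rho x * B (v i) x - B rho x * along S (v i) x)
  + 2 * expR (- (3 * rho x)) * (c x)^- 3 * c_rho x * (p_s x / rhobar) *
    (along S rho x * B (v i) x - B rho x * along S (v i) x)
  + expR (- (3 * rho x)) * (c x)^- 2 * (p_s_rho x / rhobar) *
    (B rho x * along S (v i) x - along S rho x * B (v i) x)
  + expR (- (3 * rho x)) * (c x)^- 2 * (p_s_rho x / rhobar) * S i x *
    ((\sum_a B (v a) x * sd a rho x) - divg v x * B rho x)
  + 2 * expR (- (3 * rho x)) * (c x)^- 2 * (p_s x / rhobar) * S i x *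
    (divg v x * B rho x - \sum_a B (v a) x * sd a rho x)
  + 2 * expR (- (3 * rho x)) * (c x)^- 3 * c_rho x * (p_s x / rhobar) * S i x *
    (divg v x * B rho x - \sum_a B (v a) x * sd a rho x).

Definition Q_D x : R :=
  2 * expR (- (2 * rho x)) *
    ((\sum_a \sum_b S a x * sd a (v b) x * sd b rho x) - divg v x * along S rho x).

(* In L_v the term - exp(-rho) (p_;s / rhobar) S^a d_a v^i printed in the    *)
(* literature after the first line is dropped: it is already contained in    *)
(* - c^2 exp(2 rho) C^i, and counting it twice makes the equation false,     *)
(* e.g. for the steady flow v = (x^2, 0, 0) with rho and s functions of x^2  *)
(* such that p is constant.                                                  *)
Definition L_v i x : R :=
  2 * expR (rho x) * cross (fun a => B (v a) x) (Omega^~ x) i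
  - (p_s x / rhobar) * cross (Omega^~ x) (S^~ x) i
  - 2^-1 * expR (- rho x) * (p_rho_s x / rhobar) * along S (v i) x
  - 2 * expR (- rho x) * (c x)^-1 * c_rho x * (p_s x / rhobar) * B rho x * S i x
  + expR (- rho x) * (p_s_rho x / rhobar) * B rho x * S i x.

(* The first coefficient is - 5 / 2, not - 2 as sometimes printed: - 3 / 2   *)
(* comes from the s-derivative of c and - 1 from the rho-derivative of p_;s. *)
(* The value - 2 fails for v = 0 with rho and s functions of x^1 such that p *)
(* is constant.                                                              *)
Definition L_rho x : R :=
  - (5 / 2 * expR (- rho x) * (p_s_rho x / rhobar) * along S rho x)
  - expR (- rho x) * (p_s_s x / rhobar) * dot (S^~ x) (S^~ x).

Definition L_Omega i x : R :=
  along Omega (v i) x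
  - expR (- (2 * rho x)) * (c x)^- 2 * (p_s x / rhobar) *
    cross (fun a => B (v a) x) (S^~ x) i.

Definition L_S i x : R :=
  - along S (v i) x + expR (rho x) * cross (Omega^~ x) (S^~ x) i.

Definition L_divOmega x : R := - along Omega rho x.

(* The signs of the two p_;s;s terms are opposite to those sometimes         *)
(* printed: the terms arise from - (d/ds)(c^-2 p_;s) =                       *)
(* 2 c^-3 c_;s p_;s - c^-2 p_;s;s.                                           *)
Definition L_C i x : R :=
  2 * expR (- (3 * rho x)) * (c x)^- 3 * c_s x * (p_s x / rhobar) *
    B (v i) x * dot (S^~ x) (S^~ x)
  - 2 * expR (- (3 * rho x)) * (c x)^- 3 * c_s x * (p_s x / rhobar) *
    dot (S^~ x) (fun b => B (v b) x) * S i x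
  - expR (- (3 * rho x)) * (c x)^- 2 * (p_s_s x / rhobar) *
    B (v i) x * dot (S^~ x) (S^~ x)
  + expR (- (3 * rho x)) * (c x)^- 2 * (p_s_s x / rhobar) *
    dot (fun a => B (v a) x) (S^~ x) * S i x.

End fluid_variables.

Variant unknown :=
  | U_rho | U_v of 'I_3 | U_s | U_Omega of 'I_3 | U_S of 'I_3.

Section unknown_finite.

Definition encode_unknown (A : unknown) : bool + 'I_3 * 'I_3 :=
  match A with
  | U_rho => inl true
  | U_s => inl false
  | U_v i => inr (inord 0, i)
  | U_Omega i => inr (inord 1, i)
  | U_S i => inr (inord 2, i)
  end.

Definition decode_unknown (t : bool + 'I_3 * 'I_3) : unknown :=
  match t with
  | inl b => if b then U_rho else U_s
  | inr (k, i) =>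
      if k == 0 :> nat then U_v i else if k == 1 :> nat then U_Omega i else U_S i
  end.

Lemma encode_unknownK : cancel encode_unknown decode_unknown.
Proof. by case=> //= i; rewrite inordK. Qed.

HB.instance Definition _ := Finite.copy unknown (can_type encode_unknownK).

End unknown_finite.

Section forms.
Context (R : realType).

Definition unknown_field (u : fluid R) (A : unknown) : spacetime R -> R :=
  match A with
  | U_rho => log_density u
  | U_v i => velocity u i
  | U_s => entropy u
  | U_Omega i => Omega u i
  | U_S i => egrad u i
  end.

Definition unknown_values (u : fluid R) (x : spacetime R) : unknown -> R :=
  fun A => unknown_field u A x.

(* The coefficients a and b are the same for all fluids u.                   *)
Definition null_form (rhobar : R) (p : R * R -> R)
    (Q : fluid R -> spacetime R -> R) : Prop :=
  exists (a : unknown -> unknown -> (unknown -> R) -> R)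
         (b : unknown -> unknown -> 'I_4 -> 'I_4 -> (unknown -> R) -> R),
  forall (u : fluid R) (x : spacetime R),
    Q u x =
      \sum_A1 \sum_A2 a A1 A2 (unknown_values u x) *
        ginv_form rhobar p u (unknown_field u A1) (unknown_field u A2) x
    + \sum_A1 \sum_A2 \sum_al \sum_be b A1 A2 al be (unknown_values u x) *
        (pd al (unknown_field u A1) x * pd be (unknown_field u A2) x
         - pd al (unknown_field u A2) x * pd be (unknown_field u A1) x).

Definition at_most_linear (L : fluid R -> spacetime R -> R) : Prop :=
  exists (a0 : (unknown -> R) -> R) (a : unknown -> 'I_4 -> (unknown -> R) -> R),
  forall (u : fluid R) (x : spacetime R),
    L u x = a0 (unknown_values u x)
      + \sum_A \sum_al a A al (unknown_values u x) * pd al (unknown_field u A) x.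

End forms.

(* Main.v *)
Require Import Defs.
From mathcomp Require Import all_boot all_order all_algebra.
From mathcomp Require Import all_classical all_reals all_analysis.
From mathcomp Require Import ring.
Import Order.TTheory GRing.Theory Num.Theory.
Import numFieldNormedType.Exports.
Local Open Scope classical_set_scope.
Local Open Scope ring_scope.

(** Everything is a consequence of three facts about the material derivative
B = d_t + v^a d_a along a smooth solution.

(i) B and d_a commute up to first-order terms,
B (d_a f) = d_a (B f) - (d_a v^b) d_b f (material_pd).  This rests on the
symmetry of mixed derivatives (smooth_mixed_derivC), which is obtained from
the second difference quotient and two applications of the mean value theorem.

(ii) The Euler equations give B of rho, v and s, hence, by (i), B of all their
spatial derivatives.  The only delicate point is the acceleration:
d_a (B v^i) is symmetric in (a, i) up to the single term
exp(-rho) (p_;s / rhobar) d_a rho d_i s (Dx_Dt_v).  The would-be extra terms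
in c_;s and p_;s;rho form a symmetric pair because
p_;s;rho / rhobar = 2 exp(rho) c c_;s, i.e. because p_;rho = rhobar exp(rho) c^2
and the mixed second derivatives of p agree (sound_speed_dsnd).  So the curl of
B v is quadratic in grad rho and S with no second derivatives left, and the
specific vorticity obeys a transport equation without derivative loss (Dt_Om).

(iii) The determinant of g is - c^(-6), so the wave operator is
- B B f - (div v) B f + 3 c^(-1) (B c) B f + c^2 Lap f - c grad c . grad f
(boxE, box_euler), and g^(-1)(df, dh) = - (B f) (B h) + c^2 grad f . grad h
(ginv_formE).

In the wave equation for v^i, the second derivatives left after (ii) are
c^2 (Lap v^i - d_i div v) = - c^2 (curl curl v)^i, and curl v = exp(rho) Omega,
whence a term in curl Omega, which is absorbed by the modified variable C^i (box_v).
In the wave equation for rho they reduce to a multiple of div S, absorbed by D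
(box_rho).  For the transport equation of C^i one takes the curl of the equation for
Omega: the second derivatives of v occur as Omega^c d_c (curl v)^i, which is of first
order in Omega; those of rho are cancelled by B acting on the two correction terms in
C^i, and those of s combine with B v into the products displayed in the equation
(Dt_mod_vort).  The equation for D is similar: the second derivatives of v enter as
Lap v - grad div v contracted with S, which is again a curl of Omega (Dt_mod_ent).

After these reductions each claim is, at a given point, a polynomial
identity between finitely many numbers, namely the values of the coefficients and
of the derivatives of the unknowns, checked component by component.

That the inhomogeneous terms are null forms or at most linear in the derivatives
is a statement about arbitrary fields: both classes are closed under sums and under
multiplication by functions of the undifferentiated unknowns, and each quadratic
term is a sum of the differences d_al f d_be h - d_al h d_be f
(null_form_wedge) or a multiple of g^(-1)(df, dh) (null_form_ginv). *)

Set Implicit Arguments.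
Unset Strict Implicit.

(** * Rules of differentiation *)

Section differentiation_rules.
Context {R : realType} {V : normedModType R}.
Implicit Types (f g : V -> R) (x w : V) (D : set V).

(** Differentiability is kept together with the value of one directional
derivative, so that the value for a compound expression can be computed by applying
the rules below backwards, the value being an existential variable. *)
Definition has_deriv f x w (d : R) : Prop :=
  differentiable f x /\ 'D_w f x = d.

Lemma has_deriv_self f x w : differentiable f x -> has_deriv f x w ('D_w f x).
Proof. by []. Qed.

Lemma has_deriv_eq f x w d e : has_deriv f x w d -> d = e -> has_deriv f x w e.
Proof. by move=> ? <-. Qed.

Lemma has_deriv_cst (k : R) x w : has_deriv (fun=> k) x w 0.
Proof.
by split; [exact: differentiable_cst | exact: derive_cst].
Qed.

Lemma has_derivD f g x w d e : has_deriv f x w d -> has_deriv g x w e ->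
  has_deriv (fun y => f y + g y) x w (d + e).
Proof.
move=> [df <-] [dg <-]; split; first by exact: (@differentiableD _ _ _ f g x df dg).
exact: deriveD (diff_derivable df) (diff_derivable dg).
Qed.

Lemma has_derivN f x w d : has_deriv f x w d ->
  has_deriv (fun y => - f y) x w (- d).
Proof.
move=> [df <-]; split; first exact: (differentiableN df).
exact: deriveN (diff_derivable df).
Qed.

Lemma has_derivM f g x w d e : has_deriv f x w d -> has_deriv g x w e ->
  has_deriv (fun y => f y * g y) x w (d * g x + f x * e).
Proof.
move=> [df <-] [dg <-]; split; first exact: (differentiableM df dg).
have -> := deriveM (diff_derivable df) (diff_derivable dg).
by rewrite /GRing.scale/= addrC; congr (_ + _); exact: mulrC.
Qed.

Lemma has_derivV f x w d : f x != 0 -> has_deriv f x w d ->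
  has_deriv (fun y => (f y)^-1) x w (- d * (f x)^- 2).
Proof.
move=> f0 [df <-]; split; first exact: (differentiableV df f0).
have -> := deriveV f0 (diff_derivable df).
by rewrite /GRing.scale/= mulNr mulrC mulNr.
Qed.

Lemma has_derivX f x w d n : has_deriv f x w d ->
  has_deriv (fun y => f y ^+ n.+1) x w (n.+1%:R * f x ^+ n * d).
Proof.
rewrite (_ : (fun y => _) = f ^+ n.+1); last first.
  by apply/funext => y; rewrite fctE.
move=> [df <-]; split; first exact: differentiableX.
exact: (deriveX n.+1 (diff_derivable df)).
Qed.

Lemma has_deriv_sum n (F : 'I_n -> V -> R) x w (d : 'I_n -> R) :
  (forall i, has_deriv (F i) x w (d i)) ->
  has_deriv (fun y => \sum_i F i y) x w (\sum_i d i).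
Proof.
elim: n => [|n IH] in F d * => dF.
  rewrite big_ord0 (_ : (fun y => _) = fun=> 0); first exact: has_deriv_cst.
  by apply/funext => y; rewrite big_ord0.
rewrite big_ord_recl (_ : (fun y => _) =
    fun y => F ord0 y + \sum_(i < n) F (lift ord0 i) y).
  by apply: has_derivD (dF _) _; apply: IH => i; exact: dF.
by apply/funext => y; rewrite big_ord_recl.
Qed.

Lemma has_deriv_expR f x w d : has_deriv f x w d ->
  has_deriv (fun y => expR (f y)) x w (expR (f x) * d).
Proof.
move=> [df <-].
have de : differentiable (@expR R) (f x).
  by apply/derivable1_diffP; exact: derivable_expR.
have dc := differentiable_comp df de; split; first exact: dc.
rewrite (_ : (fun y => _) = expR \o f)// deriveE// diff_comp//= deriveE//.
rewrite deriv1E//.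
by rewrite /GRing.scale/= mulrC derive1E derive_val.
Qed.

Lemma has_deriv_comp2 (h : R * R -> R) f g x w d e :
  differentiable h (f x, g x) -> has_deriv f x w d -> has_deriv g x w e ->
  has_deriv (fun y => h (f y, g y)) x w
    (d_fst h (f x, g x) * d + d_snd h (f x, g x) * e).
Proof.
move=> dh [df <-] [dg <-].
have dp := differentiable_pair df dg.
have dc : differentiable (h \o (fun y => (f y, g y))) x.
  exact: differentiable_comp.
split; first exact: dc.
rewrite (_ : (fun y => _) = h \o (fun y => (f y, g y)))// deriveE// diff_comp//=.
rewrite diff_pair//= (deriveE _ df) (deriveE _ dg) /d_fst /d_snd !deriveE//.
set a := 'd f x w; set b := 'd g x w.
rewrite (_ : (a, b) = a *: (1, 0) + b *: (0, 1)).
  by rewrite linearD !linearZ/= /GRing.scale/= mulrC [X in _ + X]mulrC.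
by congr pair; rewrite /= /GRing.scale/= !mulr1 !mulr0 ?addr0 ?add0r.
Qed.

(** The bridge to the locality of differentiability: two functions that agree near
a point differ by a function of this kind. *)
Lemma differentiable_near0 f x : (\near x, f x = 0) -> differentiable f x.
Proof.
move=> f0.
have Df : continuous (\0 : V -> R) /\ f \o shift x = cst (f x) + \0 +o_ 0 id.
  split; first exact: cst_continuous.
  apply/eqaddoP => e e0; near=> k.
  suff fk : f (k + x) = 0.
    rewrite (nbhs_singleton f0) (_ : _ k = f (k + x) - (0 + 0))//.
    by rewrite fk addr0 subr0 normr0 mulr_ge0// ltW.
  by near: k; move: f0; rewrite (near_shift 0)/= subr0.
by apply/diff_locallyP; rewrite (diff_unique Df.1 Df.2).
Unshelve. all: by end_near. Qed.

Lemma has_deriv_eq_on D f g x w d : open D -> D x ->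
  (forall y, D y -> f y = g y) -> has_deriv f x w d -> has_deriv g x w d.
Proof.
move=> oD Dx fg [df <-].
have nfg : \near x, f x = g x.
  by apply: filterS (open_nbhs_nbhs (conj oD Dx)) => y; exact: fg.
split; last by apply/esym; exact: near_eq_derive.
rewrite (_ : g = f + (g - f)); last by rewrite addrC subrK.
apply: differentiableD => //; apply: differentiable_near0.
by apply: filterS nfg => y fgy; rewrite !fctE fgy subrr.
Qed.

End differentiation_rules.

(** * Smooth functions and symmetry of mixed derivatives *)

Section smooth_functions.
Context {R : realType} {V : normedModType R}.
Implicit Types (f g : V -> R) (x w : V) (D : set V).

Lemma smooth_on_differentiable D f x : smooth_on D f -> D x -> differentiable f x.
Proof. by move=> /(_ [::]); exact. Qed.

Lemma smooth_on_derive D f w : smooth_on D f -> smooth_on D ('D_w f).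
Proof. by move=> sf l x Dx; have := sf (rcons l w) x Dx; rewrite /iter_derive foldr_rcons. Qed.

Lemma iter_derive_eq_on D f g l : open D -> (forall y, D y -> f y = g y) ->
  forall y, D y -> iter_derive f l y = iter_derive g l y.
Proof.
move=> oD fg; elim: l => [|w l IH] y Dy /=; first exact: fg.
by apply: near_eq_derive; apply: filterS (open_nbhs_nbhs (conj oD Dy)).
Qed.

(** Smoothness as a greatest fixed point: a class of differentiable functions that
is stable under directional derivatives, up to equality on D, consists of smooth
functions.  This avoids the Leibniz and Faa di Bruno formulas for iterated
derivatives. *)
Lemma smooth_on_coind D (A : (V -> R) -> Prop) : open D ->
  (forall f, A f -> forall w, exists2 g, A g &
    forall x, D x -> has_deriv f x w (g x)) ->
  forall f, A f -> smooth_on D f.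
Proof.
move=> oD stepA f Af l; elim/last_ind: l f Af => [|l w IH] f Af x Dx.
  by have [g _ /(_ x Dx)[]] := stepA f Af 0.
have [g Ag fg] := stepA f Af w.
rewrite /iter_derive foldr_rcons.
have dg := has_deriv_self 0 (IH _ Ag _ Dx).
suff [] : has_deriv (iter_derive ('D_w f) l) x 0 ('D_0 (iter_derive g l) x) by [].
apply: (has_deriv_eq_on oD Dx _ dg) => y Dy.
by apply: (iter_derive_eq_on l oD) => // z Dz; have [_ ->] := fg z Dz.
Qed.

End smooth_functions.

Section smooth_closure.
Context {R : realType} {V : normedModType R}.
Implicit Types (f g : V -> R) (x w : V) (D : set V).

(** The class to which smooth_on_coind is applied: the derivative of such an
expression is again one, by the product and chain rules. *)
Inductive smooth_expr D : (V -> R) -> Prop :=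
| SmoothBase f : smooth_on D f -> smooth_expr D f
| SmoothAdd f g : smooth_expr D f -> smooth_expr D g ->
    smooth_expr D (fun x => f x + g x)
| SmoothMul f g : smooth_expr D f -> smooth_expr D g ->
    smooth_expr D (fun x => f x * g x)
| SmoothExp f : smooth_expr D f -> smooth_expr D (fun x => expR (f x))
| SmoothComp2 E h f g : smooth_on E h -> smooth_expr D f -> smooth_expr D g ->
    (forall x, D x -> E (f x, g x)) -> smooth_expr D (fun x => h (f x, g x)).

Lemma smooth_expr_smooth D f : open D -> smooth_expr D f -> smooth_on D f.
Proof.
move=> oD; apply: (smooth_on_coind (A := smooth_expr D)) => // {}f.
elim=> {f} [f sf|f g sf IHf sg IHg|f g sf IHf sg IHg|f sf IHf
           |E h f g sh sf IHf sg IHg fgE] w.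
- exists ('D_w f); first by apply: SmoothBase; exact: smooth_on_derive.
  by move=> x Dx; apply: has_deriv_self; exact: smooth_on_differentiable sf Dx.
- have [f' sf' df] := IHf w; have [g' sg' dg] := IHg w.
  exists (fun x => f' x + g' x); first exact: SmoothAdd.
  by move=> x Dx; apply: has_derivD; [exact: df|exact: dg].
- have [f' sf' df] := IHf w; have [g' sg' dg] := IHg w.
  exists (fun x => f' x * g x + f x * g' x).
    by apply: SmoothAdd; exact: SmoothMul.
  by move=> x Dx; apply: has_derivM; [exact: df|exact: dg].
- have [f' sf' df] := IHf w.
  exists (fun x => expR (f x) * f' x).
    by apply: SmoothMul => //; exact: SmoothExp.
  by move=> x Dx; apply: has_deriv_expR; exact: df.
- have [f' sf' df] := IHf w; have [g' sg' dg] := IHg w.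
  exists (fun x => d_fst h (f x, g x) * f' x + d_snd h (f x, g x) * g' x).
    apply: SmoothAdd; apply: SmoothMul => //.
      by apply: (SmoothComp2 (h := d_fst h) _ sf sg fgE); exact: smooth_on_derive.
    by apply: (SmoothComp2 (h := d_snd h) _ sf sg fgE); exact: smooth_on_derive.
  move=> x Dx; apply: has_deriv_comp2; [|exact: df|exact: dg].
  by apply: smooth_on_differentiable sh _; exact: fgE.
Qed.

Lemma smooth_on_cst D (k : R) : smooth_on D (fun=> k).
Proof.
move=> l x Dx; suff [c ->] : exists c, iter_derive (fun=> k) l = cst c :> (V -> R).
  exact: differentiable_cst.
elim: l => [|w l [c IH]] /=; first by exists k.
by exists 0; rewrite IH; apply/funext => y; exact: derive_cst.
Qed.

Lemma smooth_onM D f g : open D -> smooth_on D f -> smooth_on D g ->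
  smooth_on D (fun x => f x * g x).
Proof.
by move=> oD sf sg; apply: smooth_expr_smooth => //; apply: SmoothMul; exact: SmoothBase.
Qed.

Lemma smooth_onD D f g : open D -> smooth_on D f -> smooth_on D g ->
  smooth_on D (fun x => f x + g x).
Proof.
by move=> oD sf sg; apply: smooth_expr_smooth => //; apply: SmoothAdd; exact: SmoothBase.
Qed.

Lemma smooth_on_expR D f : open D -> smooth_on D f ->
  smooth_on D (fun x => expR (f x)).
Proof.
by move=> oD sf; apply: smooth_expr_smooth => //; apply: SmoothExp; exact: SmoothBase.
Qed.

Lemma smooth_on_sum D n (F : 'I_n -> V -> R) : open D ->
  (forall i, smooth_on D (F i)) -> smooth_on D (fun x => \sum_i F i x).
Proof.
move=> oD; elim: n => [|n IH] in F * => sF.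
  rewrite (_ : (fun x => _) = fun=> 0); first exact: smooth_on_cst.
  by apply/funext => y; rewrite big_ord0.
rewrite (_ : (fun x => _) =
    fun x => F ord0 x + \sum_(i < n) F (lift ord0 i) x).
  by apply: smooth_onD => //; apply: IH => i; exact: sF.
by apply/funext => y; rewrite big_ord_recl.
Qed.

Lemma smooth_on_lin D (f : {linear V -> R}) : open D -> continuous f -> smooth_on D f.
Proof.
move=> oD cf.
apply: (smooth_on_coind (A := fun g => g = f \/ exists k, g = fun=> k)) => //.
  move=> g [->|[k ->]] w; last first.
    by exists (fun=> 0); [right; exists 0|move=> x _; exact: has_deriv_cst].
  exists (fun=> f w); first by right; exists (f w).
  have df x : differentiable f x by exact: linear_differentiable.
  by move=> x _; split=> //; rewrite deriveE// diff_lin.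
by left.
Qed.

End smooth_closure.

Section mixed_derivatives.
Context {R : realType} {V : normedModType R}.
Implicit Types (f : V -> R) (x a b : V) (D : set V).

(** Reduces directional derivatives to one real variable, where the mean value
theorem is available. *)
Lemma line_has_deriv f y a (t : R) : differentiable f (y + t *: a) ->
  is_derive t 1 (fun s : R => f (y + s *: a)) ('D_a f (y + t *: a)).
Proof.
move=> df.
have dl : is_diff t (fun s : R => y + s *: a) (fun s : R => s *: a).
  have -> : (fun s : R => s *: a) = 0 + (fun s : R => s *: a).
    by apply/funext => s; rewrite !fctE add0r.
  exact: is_diffD.
have dc : differentiable (f \o (fun s : R => y + s *: a)) t.
  exact: differentiable_comp.
apply: DeriveDef; first exact: diff_derivable.
rewrite (_ : (fun s : R => _) = f \o (fun s : R => y + s *: a))// deriveE//.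
by rewrite diff_comp//= diff_val scale1r deriveE.
Qed.

Lemma MVT_derivable (phi dphi : R -> R) (h : R) : 0 < h ->
  (forall t, 0 <= t <= h -> is_derive t 1 phi (dphi t)) ->
  exists2 t, 0 <= t <= h & phi h - phi 0 = dphi t * h.
Proof.
move=> h0 dphiE; have [t||t] := @MVT_segment R phi dphi 0 h (ltW h0).
- by rewrite in_itv/= => /andP[t0 th]; apply: dphiE; rewrite !ltW.
- apply: derivable_within_continuous => t; rewrite in_itv/= => /dphiE dt.
  exact: ex_derive.
- by rewrite in_itv/= subr0 => tI ->; exists t.
Qed.

(** The second difference of f, with step h in the directions a and b. *)
Definition mixed_diff f x a b (h : R) : R :=
  (f (x + h *: a + h *: b) - f (x + h *: a)) - (f (x + h *: b) - f x).

Lemma mixed_diffC f x a b h : mixed_diff f x a b h = mixed_diff f x b a h.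
Proof.
by rewrite /mixed_diff (addrAC x) !opprB addrACA [RHS]addrACA
  [_ - f (x + h *: a)]addrC.
Qed.

(** The mean value theorem along a, applied to the increment of f along b, and then
along b, applied to 'D_a f, turns the second difference into h^2 times the value of
'D_b ('D_a f) at a nearby point; that function is continuous. *)
Lemma mixed_diff_approx D f x a b (e : R) : open D -> smooth_on D f -> D x ->
  0 < e -> exists2 d : R, 0 < d & forall h, 0 < h < d ->
    `|mixed_diff f x a b h - 'D_b ('D_a f) x * h ^+ 2| <= e * h ^+ 2.
Proof.
move=> oD sf Dx e0.
have cF : {for x, continuous ('D_b ('D_a f))}.
  apply: differentiable_continuous; apply: smooth_on_differentiable Dx.
  by do 2 apply: smooth_on_derive.
have /nbhs_ballP[d /= d0 dball] : \forall y \near x,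
    D y /\ `|'D_b ('D_a f) x - 'D_b ('D_a f) y| < e.
  near=> y; split; near: y; first exact: open_nbhs_nbhs.
  by move/cvgrPdist_lt : cF; exact.
pose m := `|a| + `|b| + 1.
have m0 : 0 < m by rewrite ltr_wpDl// addr_ge0.
exists (d / m) => [|h /andP[h0 hd]]; first exact: divr_gt0.
have inball s t : 0 <= s <= h -> 0 <= t <= h -> ball x d (x + s *: a + t *: b).
  move=> /andP[s0 sh] /andP[t0 th]; rewrite -ball_normE/=.
  rewrite -addrA opprD addNKr normrN (le_lt_trans (ler_normD _ _))//.
  rewrite !normrZ !ger0_norm//.
  apply: (@le_lt_trans _ _ (h * m)); last by rewrite -ltr_pdivlMr.
  rewrite /m !mulrDr mulr1 -[leLHS]addr0 lerD ?(ltW h0)//.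
  by rewrite lerD// ler_wpM2r.
have Dball s t : 0 <= s <= h -> 0 <= t <= h -> D (x + s *: a + t *: b).
  by move=> sI tI; have [] := dball _ (inball _ _ sI tI).
have hI : 0 <= h <= h by rewrite lexx ltW.
have zI : 0 <= (0 : R) <= h by rewrite lexx ltW.
have da s : 0 <= s <= h -> is_derive s 1
    (fun s => f (x + h *: b + s *: a) - f (x + s *: a))
    ('D_a f (x + h *: b + s *: a) - 'D_a f (x + s *: a)).
  move=> sI; apply: is_deriveB; apply: line_has_deriv;
    apply: smooth_on_differentiable sf _.
    by rewrite addrAC; exact: Dball.
  by rewrite -[_ + _]addr0 -(scale0r b); exact: Dball.
have [s sI] := MVT_derivable h0 da; rewrite scale0r !addr0 => Es.
have db t : 0 <= t <= h -> is_derive t 1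
    (fun t => 'D_a f (x + s *: a + t *: b)) ('D_b ('D_a f) (x + s *: a + t *: b)).
  move=> tI; apply: line_has_deriv; apply: smooth_on_differentiable (Dball _ _ sI tI).
  exact: smooth_on_derive.
have [t tI] := MVT_derivable h0 db; rewrite scale0r addr0 => Et.
rewrite /mixed_diff (addrAC x) Es (addrAC x) Et -mulrA -expr2 -mulrBl normrM.
rewrite [X in _ * X]ger0_norm ?sqr_ge0//.
rewrite ler_wpM2r ?sqr_ge0// distrC ltW//.
by have [_] := dball _ (inball _ _ sI tI).
Unshelve. all: by end_near. Qed.

(** Both mixed derivatives approximate the same second difference quotient. *)
Lemma smooth_mixed_derivC D f x a b : open D -> smooth_on D f -> D x ->
  'D_a ('D_b f) x = 'D_b ('D_a f) x.
Proof.
move=> oD sf Dx; apply/eqP; rewrite -subr_eq0 -normr_le0.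
apply/ler_addgt0Pr => e e0; rewrite add0r.
have e2 : 0 < e / 2 by rewrite divr_gt0.
have [d d0 Ad] := mixed_diff_approx a b oD sf Dx e2.
have [d' d'0 Ad'] := mixed_diff_approx b a oD sf Dx e2.
pose h := Num.min d d' / 2.
have h0 : 0 < h by rewrite divr_gt0// lt_min d0.
have hd : h < Num.min d d' by rewrite ltr_pdivrMr// ltr_pMr ?ltr1n// lt_min d0.
have {}Ad : `|mixed_diff f x a b h - 'D_b ('D_a f) x * h ^+ 2| <= e / 2 * h ^+ 2.
  by apply: Ad; rewrite h0 (lt_le_trans hd)// ge_min lexx.
have {}Ad' : `|mixed_diff f x b a h - 'D_a ('D_b f) x * h ^+ 2| <= e / 2 * h ^+ 2.
  by apply: Ad'; rewrite h0 (lt_le_trans hd)// ge_min lexx orbT.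
rewrite -(@ler_pM2r _ (h ^+ 2)) ?exprn_gt0// -[X in _ * X]ger0_norm ?sqr_ge0//.
rewrite -normrM mulrBl [e]splitr mulrDl.
rewrite mixed_diffC in Ad'; move: Ad Ad'.
move: ('D_a ('D_b f) x) ('D_b ('D_a f) x) (mixed_diff f x a b h) => dab dba m Ad Ad'.
apply: le_trans (lerD Ad Ad').
rewrite [X in _ <= _ + X]distrC; apply: le_trans (ler_normD _ _).
by rewrite le_eqVlt; apply/orP; left; apply/eqP; congr (`|_|); ring.
Qed.

End mixed_derivatives.

(** * Equation of state *)

Section equation_of_state.
Context {R : realType}.

Lemma has_deriv_sqrt {V : normedModType R} (f : V -> R) x w d : 0 < f x ->
  has_deriv f x w d ->
  has_deriv (fun y => Num.sqrt (f y)) x w ((2 * Num.sqrt (f x))^-1 * d).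
Proof.
move=> fx0 [df <-].
have ds : differentiable (@Num.sqrt R) (f x).
  by apply/derivable1_diffP; apply: ex_derive; exact: is_derive1_sqrt.
have dc := differentiable_comp df ds; split; first exact: dc.
rewrite (_ : (fun y => _) = @Num.sqrt R \o f)// deriveE// diff_comp//= deriveE//.
rewrite deriv1E//; last by apply: ex_derive; exact: is_derive1_sqrt.
rewrite /GRing.scale/= mulrC derive1E; congr (_ * _).
by apply: derive_val; exact: is_derive1_sqrt.
Qed.

Context (rhobar : R) (p : R * R -> R) (rhobar_gt0 : 0 < rhobar)
  (p_smooth : smooth_on [set z : R * R | 0 < z.1] p)
  (c_gt0 : forall z : R * R, 0 < sound_speed rhobar p z).
Local Notation c := (sound_speed rhobar p).
Local Notation P := (eos_log rhobar p).

Definition dens (z : R * R) : R := rhobar * expR z.1.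

Lemma smooth_fst (D : set (R * R)) : open D -> smooth_on D (fun z : R * R => z.1).
Proof.
move=> oD; apply: (@smooth_on_lin _ _ D (@fst R R)) => // z; exact: cvg_fst.
Qed.

Lemma smooth_snd (D : set (R * R)) : open D -> smooth_on D (fun z : R * R => z.2).
Proof.
move=> oD; apply: (@smooth_on_lin _ _ D (@snd R R)) => // z; exact: cvg_snd.
Qed.

Lemma smooth_dens : smooth_on setT dens.
Proof.
apply: smooth_onM; [exact: openT|exact: smooth_on_cst|].
by apply: smooth_on_expR; [exact: openT|exact: smooth_fst openT].
Qed.

Lemma smooth_log_state (h : R * R -> R) : smooth_on [set z : R * R | 0 < z.1] h ->
  smooth_on setT (fun z => h (dens z, z.2)).
Proof.
move=> sh; apply: smooth_expr_smooth; first exact: openT.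
apply: (SmoothComp2 sh); [exact: SmoothBase smooth_dens| |].
  by apply: SmoothBase; exact: smooth_snd openT.
by move=> z _; rewrite /= mulr_gt0// expR_gt0.
Qed.

Lemma smooth_eos_log : smooth_on setT P.
Proof. exact: smooth_log_state. Qed.

Lemma sqr_sound_speed z : c z ^+ 2 = d_fst p (dens z, z.2).
Proof. by rewrite sqr_sqrtr// ltW// -sqrtr_gt0; exact: c_gt0. Qed.

Lemma differentiable_sound_speed z : differentiable c z.
Proof.
have sl : smooth_on setT (fun z => d_fst p (dens z, z.2)).
  by apply: smooth_log_state; exact: smooth_on_derive.
have dl : differentiable (fun z => d_fst p (dens z, z.2)) z.
  exact: smooth_on_differentiable sl _.
have l0 : 0 < d_fst p (dens z, z.2) by rewrite -sqrtr_gt0; exact: c_gt0.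
by have [] := has_deriv_sqrt (f := fun z => d_fst p (dens z, z.2)) l0 (has_deriv_self 0 dl).
Qed.

Lemma has_deriv_fst z w : has_deriv (fun z : R * R => z.1) z w w.1.
Proof.
have df : differentiable (@fst R R) z.
  by apply: linear_differentiable => y; exact: cvg_fst.
split; first exact: df.
by rewrite deriveE// (diff_lin (f := @fst R R))// => y; exact: cvg_fst.
Qed.

Lemma has_deriv_snd z w : has_deriv (fun z : R * R => z.2) z w w.2.
Proof.
have df : differentiable (@snd R R) z.
  by apply: linear_differentiable => y; exact: cvg_snd.
split; first exact: df.
by rewrite deriveE// (diff_lin (f := @snd R R))// => y; exact: cvg_snd.
Qed.

Lemma has_deriv_dens z w : has_deriv dens z w (dens z * w.1).
Proof.
apply: has_deriv_eq (has_derivM (has_deriv_cst _ _ _)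
  (has_deriv_expR (has_deriv_fst z w))) _.
by rewrite mul0r add0r mulrA.
Qed.

Lemma d_fst_eos_log z : d_fst P z = dens z * c z ^+ 2.
Proof.
rewrite sqr_sound_speed /d_fst.
have dp : differentiable p (dens z, z.2).
  by apply: smooth_on_differentiable p_smooth _; rewrite /= mulr_gt0// expR_gt0.
have [_ ->] := has_deriv_comp2 dp (has_deriv_dens z (1, 0)) (has_deriv_snd z (1, 0)).
by rewrite /= mulr0 addr0 mulr1 mulrC.
Qed.

Lemma d_snd_d_fst_eos_log z :
  d_snd (d_fst P) z = dens z * (2 * c z * d_snd c z).
Proof.
rewrite (_ : d_fst P = fun z => dens z * c z ^+ 2); last first.
  by apply/funext; exact: d_fst_eos_log.
have dc : has_deriv c z (0, 1) (d_snd c z).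
  exact/has_deriv_self/differentiable_sound_speed.
have [_] := has_derivM (has_deriv_dens z (0, 1)) (has_derivX 1 dc).
by rewrite /= mulr0 mul0r add0r expr1.
Qed.

Lemma eos_log_mixedC z : d_fst (d_snd P) z = d_snd (d_fst P) z.
Proof. exact: smooth_mixed_derivC openT smooth_eos_log _. Qed.

(** The s-derivative of p_;rho = rhobar exp(rho) c^2, after exchanging the two
derivatives of p. *)
Lemma sound_speed_dsnd z :
  d_fst (d_snd P) z / rhobar = 2 * expR z.1 * c z * d_snd c z.
Proof.
rewrite eos_log_mixedC d_snd_d_fst_eos_log /dens.
have r0 : rhobar != 0 by rewrite gt_eqF.
move: (c z) (d_snd c z) (expR z.1) => a b e.
by field.
Qed.

Lemma differentiable_dsnd_eos_log z : differentiable (d_snd P) z.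
Proof.
by apply: smooth_on_differentiable (I : setT z); apply: smooth_on_derive;
  exact: smooth_eos_log.
Qed.

End equation_of_state.

(** * Sums over space and spacetime indices *)

Local Notation e1 := (ord0 : 'I_3).
Local Notation e2 := (lift ord0 ord0 : 'I_3).
Local Notation e3 := (lift ord0 (lift ord0 ord0) : 'I_3).

Lemma sum3 {R : realType} (F : 'I_3 -> R) : \sum_a F a = F e1 + F e2 + F e3.
Proof. by rewrite !big_ord_recl big_ord0 addr0 addrA. Qed.

Lemma ord3_ind (A : 'I_3 -> Prop) : A e1 -> A e2 -> A e3 -> forall i, A i.
Proof.
move=> A1 A2 A3 [[|[|[|//]]] i3].
- by rewrite (_ : Ordinal _ = e1)//; exact: val_inj.
- by rewrite (_ : Ordinal _ = e2)//; exact: val_inj.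
- by rewrite (_ : Ordinal _ = e3)//; exact: val_inj.
Qed.

Lemma sum4 {R : realType} (F : 'I_4 -> R) :
  \sum_al F al = F ord0 + \sum_a F (lift ord0 a).
Proof. by rewrite big_ord_recl. Qed.

Lemma sum_indicator {R : realType} (T : finType) (t : T) (F : T -> R) :
  \sum_y (y == t)%:R * F y = F t.
Proof.
rewrite (bigD1 t)//= eqxx mul1r big1 ?addr0// => y /negPf ->.
by rewrite mul0r.
Qed.

(** * Calculus of fields on spacetime *)

Section field_calculus.
Context {R : realType} (rhobar : R) (p : R * R -> R) (u : fluid R)
  (U : set (spacetime R)).
Implicit Types (f g : spacetime R -> R) (x : spacetime R) (al be : 'I_4)
  (a b i j : 'I_3).

Local Notation rho := (log_density u).
Local Notation v := (velocity u).
Local Notation s := (entropy u).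
Local Notation B := (material u).

(** The spacetime vector of which B is the directional derivative (materialE). *)
Definition flow x : spacetime R :=
  delta_mx 0 ord0 + \sum_a v a x *: delta_mx 0 (lift ord0 a).

Lemma materialE f x : differentiable f x -> 'D_(flow x) f x = B f x.
Proof.
move=> df; rewrite deriveE// linearD linear_sum /material /along /sd /pd.
rewrite -deriveE//; congr (_ + _); apply: eq_bigr => a _.
by rewrite linearZ -deriveE.
Qed.

Context (rhobar_gt0 : 0 < rhobar)
  (p_smooth : smooth_on [set z : R * R | 0 < z.1] p)
  (c_gt0 : forall z : R * R, 0 < sound_speed rhobar p z)
  (oU : open U)
  (rho_smooth : smooth_on U rho) (v_smooth : forall i, smooth_on U (v i))
  (s_smooth : smooth_on U s).

Lemma has_deriv_pd al f x d : has_deriv f x (delta_mx 0 al) d -> pd al f x = d.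
Proof. by case. Qed.

Lemma has_deriv_sd a f x d :
  has_deriv f x (delta_mx 0 (lift ord0 a)) d -> sd a f x = d.
Proof. by case. Qed.

Lemma has_deriv_material f x d : has_deriv f x (flow x) d -> B f x = d.
Proof. by case=> df <-; rewrite materialE. Qed.

Lemma has_pd al f x : smooth_on U f -> U x ->
  has_deriv f x (delta_mx 0 al) (pd al f x).
Proof. by move=> sf Ux; apply/has_deriv_self/smooth_on_differentiable/Ux. Qed.

Lemma has_sd a f x : smooth_on U f -> U x ->
  has_deriv f x (delta_mx 0 (lift ord0 a)) (sd a f x).
Proof. exact: has_pd. Qed.

Lemma has_material f x : smooth_on U f -> U x -> has_deriv f x (flow x) (B f x).
Proof.
move=> sf Ux; have df : differentiable f x by exact: smooth_on_differentiable sf Ux.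
by split=> //; exact: materialE.
Qed.

Lemma smooth_pd al f : smooth_on U f -> smooth_on U (pd al f).
Proof. exact: smooth_on_derive. Qed.

Lemma smooth_sd a f : smooth_on U f -> smooth_on U (sd a f).
Proof. exact: smooth_on_derive. Qed.

Lemma smooth_material f : smooth_on U f -> smooth_on U (B f).
Proof.
move=> sf; apply: smooth_onD => //; first exact: smooth_pd.
by apply: smooth_on_sum => // a; apply: smooth_onM => //; exact: smooth_sd.
Qed.

Lemma smooth_curl (W : 'I_3 -> spacetime R -> R) i :
  (forall j, smooth_on U (W j)) -> smooth_on U (curl W i).
Proof.
move=> sW; do 2 (apply: smooth_on_sum => // ?).
by apply: smooth_onM => //; [exact: smooth_on_cst|exact: smooth_sd].
Qed.

Lemma OmegaE i : Omega u i = fun x => curl v i x * expR (- rho x).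
Proof. by apply/funext => x; rewrite expRN. Qed.

Lemma smooth_Omega i : smooth_on U (Omega u i).
Proof.
rewrite OmegaE; apply: smooth_onM => //; first exact: smooth_curl.
apply: smooth_on_expR => //.
rewrite (_ : (fun x => - rho x) = fun x => (-1) * rho x); last first.
  by apply/funext => x; rewrite mulN1r.
by apply: smooth_onM => //; exact: smooth_on_cst.
Qed.

Lemma pdC al be f x : smooth_on U f -> U x -> pd al (pd be f) x = pd be (pd al f) x.
Proof. by move=> sf Ux; exact: smooth_mixed_derivC oU sf Ux. Qed.

Lemma sdC a b f x : smooth_on U f -> U x -> sd a (sd b f) x = sd b (sd a f) x.
Proof. exact: pdC. Qed.

Lemma pd_eq_on al f g x : (forall y, U y -> f y = g y) -> U x -> pd al f x = pd al g x.
Proof.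
move=> fg Ux; apply: near_eq_derive.
by apply: filterS (open_nbhs_nbhs (conj oU Ux)) => y; exact: fg.
Qed.

Lemma sd_eq_on a f g x : (forall y, U y -> f y = g y) -> U x -> sd a f x = sd a g x.
Proof. exact: pd_eq_on. Qed.

(** The derivatives of the coefficients of B produce the last sum; the second
derivatives of f cancel because mixed derivatives agree. *)
Lemma material_pd al f x : smooth_on U f -> U x ->
  B (pd al f) x = pd al (B f) x - \sum_b pd al (v b) x * sd b f x.
Proof.
move=> sf Ux.
have dBf : pd al (B f) x = pd al (pd ord0 f) x +
    \sum_b (pd al (v b) x * sd b f x + v b x * pd al (sd b f) x).
  apply: has_deriv_pd; apply: has_derivD; first by apply: has_pd => //; exact: smooth_pd.
  apply: has_deriv_sum => b; apply: has_derivM; apply: has_pd => //.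
  exact: smooth_sd.
rewrite dBf big_split [X in _ = X - _]addrCA [X in _ = X]addrAC subrr add0r.
have sumC : \sum_b v b x * sd b (pd al f) x = \sum_b v b x * pd al (sd b f) x.
  by apply: eq_bigr => b _; exact: (congr1 _ (pdC _ _ sf Ux)).
exact: (congr2 _ (pdC _ _ sf Ux) sumC).
Qed.

Lemma material_sd a f x : smooth_on U f -> U x ->
  B (sd a f) x = sd a (B f) x - \sum_b sd a (v b) x * sd b f x.
Proof. exact: material_pd. Qed.

Lemma has_deriv_state (h : R * R -> R) x w d e :
  (forall z, differentiable h z) ->
  has_deriv rho x w d -> has_deriv s x w e ->
  has_deriv (at_state u h) x w
    (at_state u (d_fst h) x * d + at_state u (d_snd h) x * e).
Proof. by move=> dh; exact: has_deriv_comp2. Qed.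

Lemma has_deriv_csp x w d e : has_deriv rho x w d -> has_deriv s x w e ->
  has_deriv (csp rhobar p u) x w
    (csp_rho rhobar p u x * d + csp_s rhobar p u x * e).
Proof. by apply: has_deriv_state => z; exact: differentiable_sound_speed. Qed.

Lemma has_deriv_p_s x w d e : has_deriv rho x w d -> has_deriv s x w e ->
  has_deriv (p_s rhobar p u) x w
    (p_s_rho rhobar p u x * d + p_s_s rhobar p u x * e).
Proof. by apply: has_deriv_state => z; exact: differentiable_dsnd_eos_log. Qed.

(** The compatibility between the speed of sound and the pressure through which
p_;s;rho is eliminated. *)
Lemma p_s_rhoE x : p_s_rho rhobar p u x / rhobar =
  2 * expR (rho x) * csp rhobar p u x * csp_s rhobar p u x.
Proof. exact: sound_speed_dsnd rhobar_gt0 p_smooth c_gt0 (rho x, s x). Qed.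

Lemma p_rho_sE x : p_rho_s rhobar p u x = p_s_rho rhobar p u x.
Proof. by apply/esym; exact: (eos_log_mixedC rhobar_gt0 p_smooth (rho x, s x)). Qed.

End field_calculus.

(** * The acoustical metric and its wave operator *)

Section acoustic_geometry.
Context {R : realType} (rhobar : R) (p : R * R -> R) (u : fluid R).
Implicit Types (f : spacetime R -> R) (x : spacetime R) (a i : 'I_3).
Local Notation c := (csp rhobar p u).
Local Notation v := (velocity u).

(** g = A^T diag(-1, c^-2, c^-2, c^-2) A, where the rows of A are the components of
dt and dx^a - v^a dt, so that A is unitriangular. *)
Lemma det_acoustic x : \det (acoustic rhobar p u x) = - (c x)^- 6.
Proof.
pose A : 'M[R]_4 := \matrix_(al, be) (if unlift ord0 al is Some a
   then dx_vdt u a x be else dt R be).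
pose d : 'rV[R]_4 := \row_al (if al == ord0 then -1 else (c x)^- 2).
have -> : acoustic rhobar p u x = A^T *m diag_mx d *m A.
  apply/matrixP => al be; rewrite mul_mx_diag !mxE sum4 !mxE eqxx unlift_none.
  congr (_ + _); first by rewrite mulrN1 mulNr.
  rewrite mulr_sumr; apply: eq_bigr => a _.
  by rewrite !mxE liftK (eq_sym _ ord0) (negPf (neq_lift _ _)) mulrCA mulrA.
rewrite !det_mulmx det_tr det_diag.
have -> : \det A = 1.
  rewrite det_trig.
    rewrite big1// => al _; rewrite !mxE /dt /dx_vdt /dt.
    case: unliftP => [a ->|->]; last by rewrite eqxx.
    by rewrite eqxx (eq_sym _ ord0) (negPf (neq_lift _ _)) mulr0 subr0.
  apply/is_trig_mxP => al be albe; rewrite !mxE /dt /dx_vdt /dt.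
  have be0 : (be == ord0) = false by case: eqP albe => // ->; rewrite ltn0.
  case: unliftP => [a ala|_]; last by rewrite be0.
  by rewrite be0 mulr0 subr0 -ala eq_sym -val_eqE/= (ltn_eqF albe).
rewrite mul1r mulr1 big_ord_recl !mxE eqxx.
under eq_bigr do rewrite !mxE (eq_sym _ ord0) (negPf (neq_lift _ _)).
by rewrite prodr_const card_ord mulN1r -exprVn -exprM exprVn.
Qed.

Context (c_gt0 : forall z : R * R, 0 < sound_speed rhobar p z).

Lemma sqrt_det_acoustic x : Num.sqrt `|\det (acoustic rhobar p u x)| = (c x)^- 3.
Proof.
have c0 : 0 <= (c x)^- 3 by rewrite invr_ge0 exprn_ge0// ltW//; exact: c_gt0.
rewrite det_acoustic normrN (_ : (c x)^- 6 = (c x)^- 3 ^+ 2).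
  by rewrite normrX sqrtr_sqr normr_id ger0_norm.
by rewrite -!exprVn -exprM.
Qed.

Lemma Bvec0 x : Bvec u x ord0 = 1.
Proof.
rewrite /Bvec /dt eqxx big1 ?addr0// => a _.
by rewrite (negPf (neq_lift _ _)) mulr0.
Qed.

Lemma Bvec_lift x a : Bvec u x (lift ord0 a) = v a x.
Proof.
rewrite /Bvec /dt (eq_sym _ ord0) (negPf (neq_lift _ _)) add0r.
rewrite (bigD1 a)//= eqxx mulr1 big1 ?addr0// => b /negPf ba.
by rewrite (inj_eq lift_inj) eq_sym ba mulr0.
Qed.

Lemma sum_Bvec f x : \sum_be Bvec u x be * pd be f x = material u f x.
Proof.
rewrite sum4 Bvec0 mul1r /material /along; congr (_ + _).
by apply: eq_bigr => a _; rewrite Bvec_lift.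
Qed.

Lemma sum_delta f x a : \sum_be (be == lift ord0 a)%:R * pd be f x = sd a f x.
Proof. exact: sum_indicator. Qed.

(** The components of g^(-1) = - B (x) B + c^2 d_a (x) d_a applied to df. *)
Lemma acoustic_flux al f x :
  \sum_be acoustic_inv rhobar p u x al be * pd be f x =
  - (Bvec u x al * material u f x)
  + c x ^+ 2 * \sum_a (al == lift ord0 a)%:R * sd a f x.
Proof.
under [in RHS]eq_bigr do rewrite -sum_delta mulr_sumr.
rewrite exchange_big -sum_Bvec !mulr_sumr -sumrN -big_split; apply: eq_bigr => be _ /=.
rewrite mxE mulrDl mulNr -!mulrA mulr_suml; congr (_ + _ * (_ * _)).
by apply: eq_bigr => a _; rewrite mulrA.
Qed.

Lemma ginv_formE f h x : ginv_form rhobar p u f h x =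
  - (material u f x * material u h x) + c x ^+ 2 * \sum_a sd a f x * sd a h x.
Proof.
have -> : ginv_form rhobar p u f h x =
    \sum_al (- (material u h x * (Bvec u x al * pd al f x)) +
     c x ^+ 2 * \sum_a sd a h x * ((al == lift ord0 a)%:R * pd al f x)).
  apply: eq_bigr => al _.
  under eq_bigr do rewrite mulrAC; rewrite -mulr_suml acoustic_flux mulrDl mulNr.
  congr (- _ + _); first by rewrite -mulrA mulrC -mulrA [pd al f x * _]mulrC.
  rewrite -mulrA; congr (_ * _); rewrite mulr_suml; apply: eq_bigr => a _.
  by rewrite mulrAC mulrC.
rewrite big_split sumrN/= -mulr_sumr sum_Bvec mulrC -mulr_sumr exchange_big.
congr (_ + _ * _); apply: eq_bigr => a _.
by rewrite -mulr_sumr sum_delta mulrC.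
Qed.

End acoustic_geometry.

Section wave_operator.
Context {R : realType} (rhobar : R) (p : R * R -> R) (u : fluid R)
  (U : set (spacetime R)).
Implicit Types (f : spacetime R -> R) (x : spacetime R) (a : 'I_3).
Local Notation v := (velocity u).
Local Notation B := (material u).
Local Notation c := (csp rhobar p u).
Context (c_gt0 : forall z : R * R, 0 < sound_speed rhobar p z)
  (v_smooth : forall i, smooth_on U (v i)).

(** Since the square root of |det g| is c^(-3), the flux of f is
- c^(-3) (B f) B + c^(-3) c^2 d_a f d_a.  Its first part has divergence
- B (c^(-3) B f) - c^(-3) (div v) B f.  The two derivatives of products are left as
parameters, to be computed with the equations at hand. *)
Lemma boxE f x (dk : 'I_3 -> R) dBf : smooth_on U f -> U x ->
  has_deriv (fun y => (c y ^+ 3)^-1 * B f y) x (flow u x) dBf ->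
  (forall a, has_deriv (fun y => (c y ^+ 3)^-1 * (c y ^+ 2 * sd a f y)) x
      (delta_mx 0 (lift ord0 a)) (dk a)) ->
  box rhobar p u f x =
    - (c x ^+ 3 * dBf) - divg v x * B f x + c x ^+ 3 * \sum_a dk a.
Proof.
move=> sf Ux dB dk'.
pose h y := (c y ^+ 3)^-1 * B f y.
pose k a y := (c y ^+ 3)^-1 * (c y ^+ 2 * sd a f y).
have fluxE al : (fun y => Num.sqrt `|\det (acoustic rhobar p u y)| *
    \sum_be acoustic_inv rhobar p u y al be * pd be f y) =
    fun y => - (Bvec u y al * h y) + \sum_a (al == lift ord0 a)%:R * k a y.
  apply/funext => y; rewrite sqrt_det_acoustic// acoustic_flux mulrDr mulrN mulrCA.
  congr (_ + _); rewrite !mulr_sumr; apply: eq_bigr => a _.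
  by rewrite /k; move: (sd a f y) (al == _)%:R => ? ?; ring.
have dh w : has_deriv h x w ('D_w h x) by apply: has_deriv_self; case: dB.
have flux0 : pd ord0 (fun y => Num.sqrt `|\det (acoustic rhobar p u y)| *
    \sum_be acoustic_inv rhobar p u y ord0 be * pd be f y) x = - pd ord0 h x.
  rewrite fluxE; apply: has_deriv_pd.
  rewrite (_ : (fun y => _) = fun y => - h y); first exact: has_derivN (dh _).
  apply/funext => y; rewrite Bvec0 mul1r big1 ?addr0// => a _.
  by rewrite (negPf (neq_lift _ _)) mul0r.
have fluxS a : pd (lift ord0 a) (fun y => Num.sqrt `|\det (acoustic rhobar p u y)| *
    \sum_be acoustic_inv rhobar p u y (lift ord0 a) be * pd be f y) x =
    - (sd a (v a) x * h x + v a x * sd a h x) + dk a.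
  rewrite fluxE; apply: has_deriv_pd.
  rewrite (_ : (fun y => _) = fun y => - (v a y * h y) + k a y).
    apply: has_derivD; last exact: dk'.
    by apply: has_derivN; apply: has_derivM (dh _); exact: has_sd Ux.
  apply/funext => y; rewrite Bvec_lift; congr (_ + _).
  rewrite (bigD1 a)//= eqxx mul1r big1 ?addr0// => b /negPf ba.
  by rewrite (inj_eq lift_inj) eq_sym ba mul0r.
rewrite /box sum4 flux0; under eq_bigr do rewrite fluxS.
rewrite sqrt_det_acoustic// invrK big_split/= sumrN big_split/= -mulr_suml.
rewrite -(has_deriv_material dB) -/h.
rewrite -/(divg v x) -/(along v h x) /material -/h.
have c3 : c x ^+ 3 != 0 by rewrite expf_neq0// gt_eqF//; exact: c_gt0.
have hE : c x ^+ 3 * h x = pd ord0 f x + along v f x by rewrite /h mulVKf.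
rewrite -hE; move: (pd ord0 h x) (along v h x) (divg v x) (h x) (\sum_a dk a) => *.
by ring.
Qed.

End wave_operator.

(** * Solutions of the Euler equations *)

(** Sealed copies of d_a, B and Omega.  Comparing two distinct derivatives for
convertibility would otherwise unfold both to the limits that define them. *)
Fact field_seal : unit. Proof. exact: tt. Qed.
Definition Dx {R : realType} := locked_with field_seal (@sd R).
Definition Dt {R : realType} := locked_with field_seal (@material R).
Definition Om {R : realType} := locked_with field_seal (@Omega R).

Lemma DxE {R : realType} : @sd R = Dx. Proof. by rewrite /Dx unlock. Qed.
Lemma DtE {R : realType} : @material R = Dt. Proof. by rewrite /Dt unlock. Qed.
Lemma OmE {R : realType} : @Omega R = Om. Proof. by rewrite /Om unlock. Qed.

Lemma curl_split {R : realType} (X T Z : 'I_3 -> 'I_3 -> R) (k : R) i :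
  \sum_a \sum_b levi_civita R i a b * (X a b + T a b + k * Z a b) =
  \sum_a \sum_b levi_civita R i a b * X a b
  + \sum_a \sum_b levi_civita R i a b * T a b
  + k * \sum_a \sum_b levi_civita R i a b * Z a b.
Proof.
rewrite mulr_sumr -!big_split; apply: eq_bigr => a _ /=.
by rewrite mulr_sumr -!big_split; apply: eq_bigr => b _ /=; ring.
Qed.

(** The bilinear terms in the curl of the transport equation for Omega, with w and dO
for the gradients of v and Omega: the first sum collects the commutator of B with the
curl and the derivative of the first factor in Omega . grad v, and the second is
Omega^c d_c (curl v)^i, rewritten with curl v = om = exp(rho) Omega and
div Omega = - Omega . grad rho. *)
Lemma curl_commutator_algebra {R : realType} (w dO : 'I_3 -> 'I_3 -> R) i :
  let om c := \sum_a \sum_b levi_civita R c a b * w a b in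
  \sum_a \sum_b levi_civita R i a b *
    ((\sum_c dO a c * w c b) - \sum_c w a c * dO c b)
  + ((\sum_c om c * dO c i) - om i * \sum_c dO c c) =
  - 2 * (\sum_j \sum_a \sum_b levi_civita R i a b * w a j * dO b j)
  + (\sum_a \sum_j \sum_k levi_civita R a j k * w a i * dO j k)
  - (\sum_a w a a) * (\sum_a \sum_b levi_civita R i a b * dO a b).
Proof.
by rewrite /= !sum3; elim/ord3_ind: i; rewrite /levi_civita/=; ring.
Qed.

Section euler_flow.
Context {R : realType} (rhobar : R) (p : R * R -> R) (u : fluid R)
  (U : set (spacetime R)).
Implicit Types (f g : spacetime R -> R) (x : spacetime R) (a b i j : 'I_3).

Local Notation rho := (log_density u).
Local Notation v := (velocity u).
Local Notation s := (entropy u).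
Local Notation B := (Dt u).
Local Notation O := (Om u).
Local Notation c := (csp rhobar p u).
Local Notation c_r := (csp_rho rhobar p u).
Local Notation c_s := (csp_s rhobar p u).
Local Notation q x := (p_s rhobar p u x / rhobar).
Local Notation q_r x := (p_s_rho rhobar p u x / rhobar).
Local Notation q_s x := (p_s_s rhobar p u x / rhobar).
Local Notation E x := (expR (- rho x)).
Local Notation eps := (levi_civita R).

Context (rhobar_gt0 : 0 < rhobar)
  (p_smooth : smooth_on [set z : R * R | 0 < z.1] p)
  (c_gt0 : forall z : R * R, 0 < sound_speed rhobar p z)
  (oU : open U)
  (rho_smooth : smooth_on U rho) (v_smooth : forall i, smooth_on U (v i))
  (s_smooth : smooth_on U s)
  (euler : forall x, U x -> euler_at rhobar p u x).

Lemma smooth_Dx a f : smooth_on U f -> smooth_on U (Dx a f).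
Proof. by rewrite -DxE; exact: smooth_sd. Qed.

Lemma smooth_Dt f : smooth_on U f -> smooth_on U (B f).
Proof. by rewrite -DtE; exact: smooth_material. Qed.

Lemma smooth_Om i : smooth_on U (O i).
Proof. by rewrite -OmE; exact: smooth_Omega. Qed.

Lemma DxC a b f x : smooth_on U f -> U x -> Dx a (Dx b f) x = Dx b (Dx a f) x.
Proof. by rewrite -DxE; exact: sdC. Qed.

Lemma Dx_eq_on a f g x : (forall y, U y -> f y = g y) -> U x -> Dx a f x = Dx a g x.
Proof. by rewrite -DxE; exact: sd_eq_on. Qed.

Lemma Dt_Dx a f x : smooth_on U f -> U x ->
  B (Dx a f) x = Dx a (B f) x - \sum_b Dx a (v b) x * Dx b f x.
Proof. by rewrite -DxE -DtE; exact: material_sd. Qed.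

Lemma has_deriv_Dx a f x d :
  has_deriv f x (delta_mx 0 (lift ord0 a)) d -> Dx a f x = d.
Proof. by rewrite -DxE; exact: has_deriv_sd. Qed.

Lemma has_deriv_Dt f x d : has_deriv f x (flow u x) d -> B f x = d.
Proof. by rewrite -DtE; exact: has_deriv_material. Qed.

Lemma has_Dx a f x : smooth_on U f -> U x ->
  has_deriv f x (delta_mx 0 (lift ord0 a)) (Dx a f x).
Proof. by rewrite -DxE; exact: has_sd. Qed.

Lemma has_Dt f x : smooth_on U f -> U x -> has_deriv f x (flow u x) (B f x).
Proof. by rewrite -DtE; exact: has_material. Qed.

Lemma Dt_rho x : U x -> B rho x = - \sum_a Dx a (v a) x.
Proof. by rewrite -DxE -DtE; case/euler. Qed.

Lemma Dt_v i x : U x ->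
  B (v i) x = - c x ^+ 2 * Dx i rho x - E x * q x * Dx i s x.
Proof. by rewrite -DxE -DtE; case/euler => _ ->. Qed.

Lemma Dt_s x : U x -> B s x = 0.
Proof. by rewrite -DtE; case/euler. Qed.

Lemma OmegaDx i x : O i x = (\sum_a \sum_b eps i a b * Dx a (v b) x) * E x.
Proof. by rewrite -DxE -OmE OmegaE. Qed.

Lemma Om_fun i : O i = fun x => (\sum_a \sum_b eps i a b * Dx a (v b) x) * E x.
Proof. by apply/funext => x; exact: OmegaDx. Qed.

Lemma has_Dx_c a x : U x -> has_deriv c x (delta_mx 0 (lift ord0 a))
  (c_r x * Dx a rho x + c_s x * Dx a s x).
Proof. by move=> Ux; apply: has_deriv_csp => //; exact: has_Dx. Qed.

Lemma has_Dx_q a x : U x ->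
  has_deriv (p_s rhobar p u) x (delta_mx 0 (lift ord0 a))
    (p_s_rho rhobar p u x * Dx a rho x + p_s_s rhobar p u x * Dx a s x).
Proof. by move=> Ux; apply: has_deriv_p_s => //; exact: has_Dx. Qed.

Lemma has_Dt_c x : U x -> has_deriv c x (flow u x) (c_r x * B rho x).
Proof.
move=> Ux; rewrite -[X in has_deriv _ _ _ X]addr0 -(mulr0 (c_s x)) -(Dt_s Ux).
by apply: has_deriv_csp => //; exact: has_Dt.
Qed.

Lemma has_Dt_q x : U x ->
  has_deriv (p_s rhobar p u) x (flow u x) (p_s_rho rhobar p u x * B rho x).
Proof.
move=> Ux; rewrite -[X in has_deriv _ _ _ X]addr0 -(mulr0 (p_s_s rhobar p u x)) -(Dt_s Ux).
by apply: has_deriv_p_s => //; exact: has_Dt.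
Qed.

Ltac smooth := repeat first
  [ exact: rho_smooth | exact: v_smooth | exact: s_smooth | exact: smooth_Om
  | apply: smooth_Dx | apply: smooth_Dt ].

(** Computes the value in a goal has_deriv f x w ?d by recursion on the expression f,
for w a spatial basis vector or the material direction. *)
Ltac differentiate Ux := lazymatch goal with
  | df : has_deriv ?f ?x ?w _ |- has_deriv ?f ?x ?w _ => exact: df
  | |- has_deriv (fun _ => ?k) _ _ _ => exact: has_deriv_cst
  | |- has_deriv (fun y => @?f y + @?g y) _ _ _ =>
      eapply (has_derivD (f := f) (g := g)); differentiate Ux
  | |- has_deriv (fun y => @?f y * @?g y) _ _ _ =>
      eapply (has_derivM (f := f) (g := g)); differentiate Ux
  | |- has_deriv (fun y => - @?f y) _ _ _ =>
      eapply (has_derivN (f := f)); differentiate Ux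
  | |- has_deriv (fun y => @?f y ^+ _) _ _ _ =>
      eapply (has_derivX (f := f)); differentiate Ux
  | |- has_deriv (fun y => (@?f y)^-1) _ _ _ =>
      eapply (has_derivV (f := f)); [|differentiate Ux]
  | |- has_deriv (fun y => expR (@?f y)) _ _ _ =>
      eapply (has_deriv_expR (f := f)); differentiate Ux
  | |- has_deriv (fun y => csp _ _ _ y) _ (delta_mx _ _) _ => exact: (has_Dx_c _ Ux)
  | |- has_deriv (fun y => csp _ _ _ y) _ (flow _ _) _ => exact: (has_Dt_c Ux)
  | |- has_deriv (fun y => p_s _ _ _ y) _ (delta_mx _ _) _ => exact: (has_Dx_q _ Ux)
  | |- has_deriv (fun y => p_s _ _ _ y) _ (flow _ _) _ => exact: (has_Dt_q Ux)
  | |- has_deriv (fun y => ?h y) _ (flow _ _) _ =>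
      eapply (@has_Dt h); [smooth | exact: Ux]
  | |- has_deriv (fun y => ?h y) _ (delta_mx _ _) _ =>
      eapply (@has_Dx _ h); [smooth | exact: Ux]
  | |- _ => eapply has_deriv_sum; intro; differentiate Ux
  end.

(** Turns the values of the fields into variables before polynomial normalization. *)
Ltac atoms := repeat match goal with
  | |- context [Dx ?a ?f ?x] => generalize (Dx a f x); intro
  | |- context [Om ?a ?f ?x] => generalize (Om a f x); intro
  | |- context [Dt ?a ?f ?x] => generalize (Dt a f x); intro
  | |- context [csp ?a ?b ?c ?x] => generalize (csp a b c x); intro
  | |- context [csp_rho ?a ?b ?c ?x] => generalize (csp_rho a b c x); intro
  | |- context [csp_s ?a ?b ?c ?x] => generalize (csp_s a b c x); intro
  | |- context [p_s ?a ?b ?c ?x] => generalize (p_s a b c x); intro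
  | |- context [p_s_rho ?a ?b ?c ?x] => generalize (p_s_rho a b c x); intro
  | |- context [p_s_s ?a ?b ?c ?x] => generalize (p_s_s a b c x); intro
  | |- context [expR ?x] => generalize (expR x); intro
  end.

(** * Transport equations *)

Lemma p_s_rho_subst x :
  p_s_rho rhobar p u x = 2 * expR (rho x) * c x * c_s x * rhobar.
Proof.
have r0 : rhobar != 0 by rewrite gt_eqF.
by apply: (canRL (divfK r0)); exact: p_s_rhoE.
Qed.

(** The parenthesis is symmetric in a and i, so that only the last term contributes to
the curl of B v. *)
Lemma Dx_Dt_v a i x : U x -> Dx a (B (v i)) x =
  - (2 * c x * c_r x * Dx a rho x * Dx i rho x
     + 2 * c x * c_s x * (Dx a s x * Dx i rho x + Dx a rho x * Dx i s x)
     + c x ^+ 2 * Dx a (Dx i rho) x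
     + E x * q_s x * Dx a s x * Dx i s x + E x * q x * Dx a (Dx i s) x)
  + E x * q x * Dx a rho x * Dx i s x.
Proof.
move=> Ux; rewrite (Dx_eq_on a (Dt_v i) Ux).
apply: has_deriv_Dx; apply: has_deriv_eq; first by differentiate Ux.
have r0 : rhobar != 0 by rewrite gt_eqF.
have : expR (rho x) != 0 by rewrite gt_eqF// expR_gt0.
rewrite p_s_rho_subst expRN; atoms => ?; field; exact/andP.
Qed.

Lemma Dt_Dx_rho a x : U x -> B (Dx a rho) x =
  - (\sum_b Dx a (Dx b (v b)) x) - \sum_b Dx a (v b) x * Dx b rho x.
Proof.
move=> Ux; rewrite Dt_Dx//; congr (_ - _); rewrite (Dx_eq_on a Dt_rho Ux).
by apply: has_deriv_Dx; differentiate Ux.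
Qed.

Lemma Dt_Dx_s a x : U x -> B (Dx a s) x = - \sum_b Dx a (v b) x * Dx b s x.
Proof.
move=> Ux; rewrite Dt_Dx// (Dx_eq_on a Dt_s Ux).
by rewrite (has_deriv_Dx (has_deriv_cst 0 x _)) add0r.
Qed.

(** Brings the mixed second derivatives of f into one of the two orders. *)
Ltac symmetric f_smooth Ux :=
  rewrite ?(DxC e2 e1 f_smooth Ux) ?(DxC e3 e1 f_smooth Ux) ?(DxC e3 e2 f_smooth Ux).

(** The curl of B v contributes the last term; the rest is the classical identity
that turns the commutator and - (B rho) Omega = (div v) Omega into vortex
stretching. *)
Lemma Dt_Om i x : U x -> B (O i) x = \sum_a O a x * Dx a (v i) x
  + E x ^+ 2 * q x * \sum_a \sum_b eps i a b * Dx a rho x * Dx b s x.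
Proof.
move=> Ux; rewrite {1}Om_fun.
apply: has_deriv_Dt; apply: has_deriv_eq; first by differentiate Ux.
rewrite !(sum3, OmegaDx, Dt_Dx, Dx_Dt_v, Dt_rho)//.
symmetric rho_smooth Ux; symmetric s_smooth Ux.
by elim/ord3_ind: i; rewrite /levi_civita /=; atoms; ring.
Qed.

Lemma Dx_Om a b x : U x -> Dx a (O b) x =
  (\sum_i \sum_j eps b i j * Dx a (Dx i (v j)) x) * E x - O b x * Dx a rho x.
Proof.
move=> Ux; rewrite {1}Om_fun; apply: has_deriv_Dx; apply: has_deriv_eq.
  by differentiate Ux.
by rewrite OmegaDx !sum3; atoms; ring.
Qed.

Ltac symmetric_v Ux :=
  symmetric (v_smooth e1) Ux; symmetric (v_smooth e2) Ux; symmetric (v_smooth e3) Ux.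

(** curl v = exp(rho) Omega is divergence free. *)
Lemma div_Om x : U x -> \sum_a Dx a (O a) x = - \sum_a O a x * Dx a rho x.
Proof.
move=> Ux; rewrite !(sum3, Dx_Om)//; symmetric_v Ux.
by rewrite /levi_civita /=; atoms; ring.
Qed.

(** curl curl v = grad div v - Lap v, with curl v = exp(rho) Omega. *)
Lemma Lap_v i x : U x -> \sum_a Dx a (Dx a (v i)) x =
  \sum_a Dx i (Dx a (v a)) x
  - expR (rho x) * \sum_a \sum_b eps i a b * (Dx a rho x * O b x + Dx a (O b) x).
Proof.
move=> Ux; rewrite !(sum3, Dx_Om)//.
have : expR (rho x) != 0 by rewrite gt_eqF// expR_gt0.
rewrite expRN; elim/ord3_ind: i; symmetric_v Ux;
  by rewrite /levi_civita /=; atoms => ?; field.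
Qed.

Lemma Dx_Dt_Om a i x : U x -> Dx a (B (O i)) x =
  (\sum_b (Dx a (O b) x * Dx b (v i) x + O b x * Dx a (Dx b (v i)) x))
  + E x ^+ 2 * ((q_r x - 2 * q x) * Dx a rho x + q_s x * Dx a s x) *
     (\sum_j \sum_k eps i j k * Dx j rho x * Dx k s x)
  + E x ^+ 2 * q x * (\sum_j \sum_k eps i j k *
     (Dx a (Dx j rho) x * Dx k s x + Dx j rho x * Dx a (Dx k s) x)).
Proof.
move=> Ux; rewrite (Dx_eq_on a (Dt_Om i) Ux).
apply: has_deriv_Dx; apply: has_deriv_eq; first by differentiate Ux.
by rewrite !sum3; atoms; ring.
Qed.

(** The commutator of B with the curl, combined with the curl of Dt_Om.  The second
derivatives of v occur only as Omega^c d_c (curl v)^i, of first order in Omega. *)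
Lemma Dt_curl_Om i x : U x ->
  \sum_a \sum_b eps i a b * B (Dx a (O b)) x =
  - 2 * (\sum_j \sum_a \sum_b eps i a b * Dx a (v j) x * Dx b (O j) x)
  + (\sum_a \sum_j \sum_k eps a j k * Dx a (v i) x * Dx j (O k) x)
  - (\sum_a Dx a (v a) x) * (\sum_a \sum_b eps i a b * Dx a (O b) x)
  + E x ^+ 2 * \sum_a \sum_b eps i a b *
    (((q_r x - 2 * q x) * Dx a rho x + q_s x * Dx a s x) *
       (\sum_j \sum_k eps b j k * Dx j rho x * Dx k s x)
     + q x * (\sum_j \sum_k eps b j k *
          (Dx a (Dx j rho) x * Dx k s x + Dx j rho x * Dx a (Dx k s) x))).
Proof.
move=> Ux.
pose w a b := Dx a (v b) x; pose dO a b := Dx a (O b) x.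
pose T a b := \sum_c O c x * Dx a (Dx c (v b)) x.
pose Z a b := ((q_r x - 2 * q x) * Dx a rho x + q_s x * Dx a s x) *
       (\sum_j \sum_k eps b j k * Dx j rho x * Dx k s x)
     + q x * (\sum_j \sum_k eps b j k *
          (Dx a (Dx j rho) x * Dx k s x + Dx j rho x * Dx a (Dx k s) x)).
pose om c := \sum_a \sum_b eps c a b * w a b.
(* Both sides are Omega^c d_c (curl v)^i. *)
have TE : \sum_a \sum_b eps i a b * T a b =
    (\sum_c om c * dO c i) - om i * \sum_c dO c c.
  rewrite /dO (div_Om Ux) !sum3 !(Dx_Om _ _ Ux) /T !sum3 !OmegaDx.
  rewrite -!/(om _); move: om => om.
  elim/ord3_ind: i; symmetric_v Ux; rewrite /levi_civita /=; atoms; ring.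
transitivity (\sum_a \sum_b eps i a b *
    ((\sum_c dO a c * w c b) - (\sum_c w a c * dO c b) + T a b + E x ^+ 2 * Z a b)).
  apply: eq_bigr => a _; apply: eq_bigr => b _; congr (_ * _).
  rewrite (Dt_Dx _ (smooth_Om _) Ux) (Dx_Dt_Om _ _ Ux) /w /dO /T /Z !sum3.
  by atoms; ring.
rewrite curl_split TE; have /= -> // := curl_commutator_algebra w dO i.
Qed.

Lemma expRNn n x : expR (- (n%:R * rho x)) = E x ^+ n.
Proof. by rewrite -mulrN expRM_natl. Qed.

Lemma mod_vortE i : mod_vort rhobar p u i = fun x =>
  E x * (\sum_a \sum_b eps i a b * Dx a (O b) x)
  + E x ^+ 3 * (c x ^+ 2)^-1 * q x * (\sum_a Dx a s x * Dx a (v i) x)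
  - E x ^+ 3 * (c x ^+ 2)^-1 * q x * (\sum_a Dx a (v a) x) * Dx i s x.
Proof.
apply/funext => x; rewrite /mod_vort /curl /along /divg /egrad DxE OmE.
by rewrite (expRNn 3).
Qed.

(** The second derivatives of rho in the curl of Dt_Om cancel against those in
B (S^a d_a v^i - (div v) S^i), which come from the gradient of the acceleration; those
of s combine into products with c^2 grad rho + exp(-rho) (p_;s / rhobar) S = - B v. *)
Lemma Dt_mod_vort i x : U x -> B (mod_vort rhobar p u i) x =
  - 2 * (\sum_j \sum_a \sum_b eps i a b * E x * Dx a (v j) x * Dx b (O j) x)
  + (\sum_a \sum_j \sum_k eps a j k * E x * Dx a (v i) x * Dx j (O k) x)
  + E x ^+ 3 * (c x ^+ 2)^-1 * q x * ((\sum_a B (Dx a s) x * Dx a (v i) x)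
      - B (v i) x * (\sum_a Dx a (Dx a s) x))
  + E x ^+ 3 * (c x ^+ 2)^-1 * q x * ((\sum_a B (v a) x * Dx a (Dx i s) x)
      - (\sum_a Dx a (v a) x) * B (Dx i s) x)
  + Q_C rhobar p u i x + L_C rhobar p u i x.
Proof.
move=> Ux; rewrite mod_vortE.
have c0 : c x != 0 by rewrite gt_eqF//; exact: c_gt0.
have e0 : expR (rho x) != 0 by rewrite gt_eqF// expR_gt0.
have r0 : rhobar != 0 by rewrite gt_eqF.
have dcurl : has_deriv (fun x => \sum_a \sum_b eps i a b * Dx a (O b) x) x (flow u x)
    (\sum_a \sum_b eps i a b * B (Dx a (O b)) x).
  apply: has_deriv_sum => a; apply: has_deriv_sum => b; apply: has_deriv_eq.
    by differentiate Ux.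
  by rewrite mul0r add0r.
apply: has_deriv_Dt; apply: has_deriv_eq; first by differentiate Ux; rewrite ?expf_neq0.
rewrite (Dt_curl_Om _ Ux) /Q_C /L_C /dot /along /divg /egrad DxE DtE.
rewrite (expRNn 3) p_s_rho_subst expRN.
rewrite !(sum3, Dt_Dx_s _ Ux, Dt_Dx, Dx_Dt_v, Dt_v, Dt_rho)//.
move: c0 e0 r0.
by elim/ord3_ind: i dcurl => _; symmetric rho_smooth Ux; symmetric s_smooth Ux;
  rewrite /levi_civita /=; atoms => *; field; exact/and3P.
Qed.

Lemma Dt_egrad i x : U x -> B (egrad u i) x = L_S u i x.
Proof.
move=> Ux; rewrite /egrad /L_S /along /cross /egrad DxE OmE (Dt_Dx_s _ Ux).
have : expR (rho x) != 0 by rewrite gt_eqF// expR_gt0.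
rewrite !(sum3, OmegaDx) expRN.
by elim/ord3_ind: i; rewrite /levi_civita /=; atoms => *; field.
Qed.

Lemma Dt_Omega i x : U x -> B (O i) x = L_Omega rhobar p u i x.
Proof.
move=> Ux; rewrite (Dt_Om _ Ux) /L_Omega /along /cross /egrad DxE DtE OmE (expRNn 2).
have c0 : c x != 0 by rewrite gt_eqF//; exact: c_gt0.
have r0 : rhobar != 0 by rewrite gt_eqF.
rewrite !(sum3, Dt_v)//; move: c0 r0.
by elim/ord3_ind: i; rewrite /levi_civita /=; atoms => *; field; exact/andP.
Qed.

Lemma Dx_Dt_Dx_s a b x : U x -> Dx a (B (Dx b s)) x =
  - \sum_j (Dx a (Dx b (v j)) x * Dx j s x + Dx b (v j) x * Dx a (Dx j s) x).
Proof.
move=> Ux; rewrite (Dx_eq_on a (Dt_Dx_s b) Ux).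
by apply: has_deriv_Dx; differentiate Ux.
Qed.

Lemma mod_entE : mod_ent u = fun x =>
  E x ^+ 2 * (\sum_a Dx a (Dx a s) x) - E x ^+ 2 * (\sum_a Dx a s x * Dx a rho x).
Proof.
apply/funext => x; rewrite /mod_ent /along /divg /egrad DxE.
by rewrite (expRNn 2).
Qed.

(** Third derivatives of s do not appear since B s = 0; the second derivatives of v
appear only as S^b (Lap v^b - d_b div v) = - S . curl curl v. *)
Lemma Dt_mod_ent x : U x -> B (mod_ent u) x =
  2 * E x ^+ 2 * ((\sum_a Dx a (v a) x) * (\sum_a Dx a (Dx a s) x)
    - \sum_a \sum_b Dx a (v b) x * Dx b (Dx a s) x)
  + E x * (\sum_a (\sum_i \sum_j eps a i j * Dx i (O j) x) * Dx a s x)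
  + Q_D u x.
Proof.
move=> Ux; rewrite mod_entE.
apply: has_deriv_Dt; apply: has_deriv_eq; first by differentiate Ux.
rewrite /Q_D /along /divg /egrad DxE (expRNn 2).
rewrite !(sum3, Dx_Om _ _ Ux, Dt_Dx _ (smooth_Dx _ s_smooth) Ux, Dx_Dt_Dx_s _ _ Ux).
rewrite !(sum3, Dt_Dx_s _ Ux, Dt_Dx_rho _ Ux, Dt_rho Ux, OmegaDx).
symmetric s_smooth Ux; symmetric_v Ux.
by rewrite /levi_civita /=; atoms => *; ring.
Qed.

Lemma egradDx i : egrad u i = Dx i s.
Proof. by rewrite -DxE. Qed.

Lemma divg_Omega x : U x -> divg O x = L_divOmega u x.
Proof. by move=> Ux; rewrite /divg /L_divOmega /along DxE OmE div_Om. Qed.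

Lemma curl_egrad i x : U x -> curl (egrad u) i x = 0.
Proof.
move=> Ux; rewrite /curl DxE !sum3 !egradDx; symmetric s_smooth Ux.
by elim/ord3_ind: i; rewrite /levi_civita /=; atoms => *; ring.
Qed.

(** * Wave equations *)

(** B s = 0 enters through B c = c_;rho B rho. *)
Lemma box_euler f x : smooth_on U f -> U x -> box rhobar p u f x =
  - B (B f) x - (\sum_a Dx a (v a) x) * B f x
  + 3 * (c x)^-1 * c_r x * B rho x * B f x + c x ^+ 2 * (\sum_a Dx a (Dx a f) x)
  - c x * \sum_a (c_r x * Dx a rho x + c_s x * Dx a s x) * Dx a f x.
Proof.
move=> sf Ux.
have c0 : c x != 0 by rewrite gt_eqF//; exact: c_gt0.
rewrite (boxE c_gt0 v_smooth sf Ux (dBf := (c x ^+ 3)^-1 * B (B f) x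
    - 3 * (c x ^+ 4)^-1 * (c_r x * B rho x) * B f x)
  (dk := fun a => - (c x ^+ 2)^-1 * (c_r x * Dx a rho x + c_s x * Dx a s x) * Dx a f x
    + (c x)^-1 * Dx a (Dx a f) x)).
- rewrite /divg DxE DtE !sum3; move: c0; atoms => *; field; by [].
- rewrite DtE; apply: has_deriv_eq.
    by differentiate Ux; rewrite ?expf_neq0.
  by move: c0; atoms => *; field.
- move=> a; rewrite DxE; apply: has_deriv_eq.
    by differentiate Ux; rewrite ?expf_neq0.
  by move: c0; atoms => *; field.
Qed.

Lemma Dt_eq_on f g x : smooth_on U f -> (forall y, U y -> f y = g y) -> U x ->
  B f x = B g x.
Proof.
move=> sf fg Ux; apply/esym; apply: has_deriv_Dt.
exact: (has_deriv_eq_on oU Ux fg (has_Dt sf Ux)).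
Qed.

(** - B (B rho) = B (div v) is, up to products of first derivatives, the divergence of the
acceleration - c^2 grad rho - exp(-rho) (p_;s / rhobar) S.  Its part - c^2 Lap rho is
cancelled by the spatial part of the wave operator. *)
Lemma box_rho x : U x -> box rhobar p u rho x =
  - expR (rho x) * q x * mod_ent u x + Q_rho rhobar p u x + L_rho rhobar p u x.
Proof.
move=> Ux; rewrite (box_euler rho_smooth Ux).
have c0 : c x != 0 by rewrite gt_eqF//; exact: c_gt0.
have e0 : expR (rho x) != 0 by rewrite gt_eqF// expR_gt0.
have r0 : rhobar != 0 by rewrite gt_eqF.
rewrite (Dt_eq_on (smooth_Dt rho_smooth) Dt_rho Ux).
have -> : B (fun x => - \sum_a Dx a (v a) x) x = - \sum_a B (Dx a (v a)) x.
  by apply: has_deriv_Dt; differentiate Ux.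
rewrite /Q_rho ginv_formE mod_entE /L_rho /dot /along /egrad DxE DtE.
rewrite !(sum3, Dt_Dx _ (v_smooth _) Ux, Dx_Dt_v, Dt_v, Dt_rho)// p_s_rho_subst expRN.
move: c0 e0 r0; symmetric rho_smooth Ux; symmetric s_smooth Ux.
by atoms => *; field; exact/and3P.
Qed.

(** The second derivatives in B (B v^i) are those of - c^2 B (d_i rho), namely
c^2 d_i div v.  Subtracted from c^2 Lap v^i they give a curl of the vorticity, by
Lap_v. *)
Lemma box_v i x : U x -> box rhobar p u (v i) x =
  - c x ^+ 2 * expR (2 * rho x) * mod_vort rhobar p u i x
  + Q_v rhobar p u i x + L_v rhobar p u i x.
Proof.
move=> Ux; rewrite (box_euler (v_smooth i) Ux).
have c0 : c x != 0 by rewrite gt_eqF//; exact: c_gt0.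
have e0 : expR (rho x) != 0 by rewrite gt_eqF// expR_gt0.
have r0 : rhobar != 0 by rewrite gt_eqF.
rewrite (Lap_v _ Ux) (Dt_eq_on (smooth_Dt (v_smooth i)) (Dt_v i) Ux).
have -> : B (fun x => - c x ^+ 2 * Dx i rho x - E x * q x * Dx i s x) x =
    - (2 * c x * c_r x * B rho x * Dx i rho x + c x ^+ 2 * B (Dx i rho) x)
    + E x * B rho x * q x * Dx i s x - E x * q_r x * B rho x * Dx i s x
    - E x * q x * B (Dx i s) x.
  apply: has_deriv_Dt; apply: has_deriv_eq; first by differentiate Ux.
  by atoms => *; ring.
rewrite /Q_v ginv_formE mod_vortE /L_v /cross /along /egrad DxE DtE OmE.
rewrite (expRM_natl 2) p_rho_sE//.
rewrite (Dt_Dx_rho _ Ux) (Dt_Dx_s _ Ux) (Dt_rho Ux) p_s_rho_subst.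
rewrite !(sum3, Dt_v, OmegaDx)// expRN.
move: c0 e0 r0; elim/ord3_ind: i; rewrite /levi_civita /=; symmetric_v Ux;
  by atoms => *; field; exact/and3P.
Qed.

End euler_flow.

(** * Null forms and terms linear in the derivatives *)

Section null_and_linear_forms.
Context {R : realType} (rhobar : R) (p : R * R -> R).
Local Notation field := (fluid R -> spacetime R -> R).
Implicit Types (Q L k : field) (A : unknown).

(** Functions of the undifferentiated unknowns, in the sense of the coefficients in
null_form and at_most_linear. *)
Definition coefficient k : Prop :=
  exists k0 : (unknown -> R) -> R, forall u x, k u x = k0 (unknown_values u x).

Lemma coefficient_cst (r : R) : coefficient (fun _ _ => r).
Proof. by exists (fun=> r). Qed.

Lemma coefficient_unknown A : coefficient (fun u => unknown_field u A).
Proof. by exists (fun w => w A). Qed.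

Lemma coefficient_state (h : R * R -> R) : coefficient (fun u => at_state u h).
Proof. by exists (fun w => h (w U_rho, w U_s)). Qed.

Lemma coefficientD k l : coefficient k -> coefficient l ->
  coefficient (fun u x => k u x + l u x).
Proof. by move=> [k0 kE] [l0 lE]; exists (fun w => k0 w + l0 w) => u x; rewrite kE lE. Qed.

Lemma coefficientM k l : coefficient k -> coefficient l ->
  coefficient (fun u x => k u x * l u x).
Proof. by move=> [k0 kE] [l0 lE]; exists (fun w => k0 w * l0 w) => u x; rewrite kE lE. Qed.

Lemma coefficient_comp (h : R -> R) k : coefficient k ->
  coefficient (fun u x => h (k u x)).
Proof. by move=> [k0 kE]; exists (h \o k0) => u x; rewrite /= kE. Qed.

Lemma coefficient_sum (F : 'I_3 -> field) : (forall i, coefficient (F i)) ->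
  coefficient (fun u x => \sum_i F i u x).
Proof.
move=> cF; have [F1 F1E] := cF e1; have [F2 F2E] := cF e2; have [F3 F3E] := cF e3.
by exists (fun w => F1 w + F2 w + F3 w) => u x; rewrite sum3 F1E F2E F3E.
Qed.

Lemma null_form_eq Q Q' : (forall u x, Q u x = Q' u x) ->
  null_form rhobar p Q -> null_form rhobar p Q'.
Proof. by move=> QQ' [a [b QE]]; exists a, b => u x; rewrite -QQ' QE. Qed.

Lemma null_formD Q Q' : null_form rhobar p Q -> null_form rhobar p Q' ->
  null_form rhobar p (fun u x => Q u x + Q' u x).
Proof.
move=> [a [b QE]] [a' [b' QE']].
exists (fun A1 A2 w => a A1 A2 w + a' A1 A2 w).
exists (fun A1 A2 al be w => b A1 A2 al be w + b' A1 A2 al be w) => u x.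
rewrite QE QE' addrACA; congr (_ + _); rewrite -big_split; apply: eq_bigr => A1 _;
  rewrite -big_split; apply: eq_bigr => A2 _; first by rewrite /= mulrDl.
rewrite -big_split; apply: eq_bigr => al _.
by rewrite -big_split; apply: eq_bigr => be _; rewrite /= mulrDl.
Qed.

Lemma null_formM k Q : coefficient k -> null_form rhobar p Q ->
  null_form rhobar p (fun u x => k u x * Q u x).
Proof.
move=> [k0 kE] [a [b QE]].
exists (fun A1 A2 w => k0 w * a A1 A2 w).
exists (fun A1 A2 al be w => k0 w * b A1 A2 al be w) => u x.
rewrite QE kE mulrDr !mulr_sumr; congr (_ + _); apply: eq_bigr => A1 _;
  rewrite !mulr_sumr; apply: eq_bigr => A2 _; first by rewrite mulrA.
by rewrite !mulr_sumr; apply: eq_bigr => al _;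
  rewrite !mulr_sumr; apply: eq_bigr => be _; rewrite mulrA.
Qed.

Lemma null_form_sum (F : 'I_3 -> field) :
  (forall i, null_form rhobar p (F i)) ->
  null_form rhobar p (fun u x => \sum_i F i u x).
Proof.
move=> nF; apply: null_form_eq (null_formD (null_formD (nF e1) (nF e2)) (nF e3)).
by move=> u x; rewrite sum3.
Qed.

Lemma null_form_ginv A A' : null_form rhobar p
  (fun u => ginv_form rhobar p u (unknown_field u A) (unknown_field u A')).
Proof.
exists (fun A1 A2 _ => (A1 == A)%:R * (A2 == A')%:R), (fun _ _ _ _ _ => 0) => u x.
rewrite [X in _ = _ + X]big1 ?addr0 => [|A1 _]; last first.
  rewrite big1// => A2 _; rewrite big1// => al _; rewrite big1// => be _.
  by rewrite mul0r.
under eq_bigr => A1 _ do under eq_bigr => A2 _ do rewrite -mulrA.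
under eq_bigr => A1 _ do rewrite -mulr_sumr sum_indicator.
by rewrite sum_indicator.
Qed.

Lemma null_form_wedge A A' al be : null_form rhobar p
  (fun u x => pd al (unknown_field u A) x * pd be (unknown_field u A') x
            - pd al (unknown_field u A') x * pd be (unknown_field u A) x).
Proof.
exists (fun _ _ _ => 0).
exists (fun A1 A2 al' be' _ =>
  (A1 == A)%:R * ((A2 == A')%:R * ((al' == al)%:R * (be' == be)%:R))) => u x.
rewrite [X in _ = X + _]big1 ?add0r => [|A1 _]; last first.
  by rewrite big1// => A2 _; rewrite mul0r.
under eq_bigr => A1 _ do under eq_bigr => A2 _ do under eq_bigr => al' _ do
  under eq_bigr => be' _ do rewrite -!mulrA.
under eq_bigr => A1 _ do under eq_bigr => A2 _ do under eq_bigr => al' _ do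
  rewrite -!mulr_sumr sum_indicator.
under eq_bigr => A1 _ do under eq_bigr => A2 _ do rewrite -!mulr_sumr sum_indicator.
under eq_bigr => A1 _ do rewrite -!mulr_sumr sum_indicator.
by rewrite sum_indicator.
Qed.

(** B is a combination of the d_be with coefficients 1 and v^b. *)
Lemma null_form_material A A' a : null_form rhobar p
  (fun u x => material u (unknown_field u A) x * sd a (unknown_field u A') x
            - material u (unknown_field u A') x * sd a (unknown_field u A) x).
Proof.
apply: null_form_eq (null_formD (null_form_wedge A A' ord0 (lift ord0 a))
  (null_form_sum (F := fun b u x => unknown_field u (U_v b) x *
    (pd (lift ord0 b) (unknown_field u A) x * pd (lift ord0 a) (unknown_field u A') x
     - pd (lift ord0 b) (unknown_field u A') x * pd (lift ord0 a) (unknown_field u A) x))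
  (fun b => null_formM (coefficient_unknown (U_v b))
    (null_form_wedge A A' (lift ord0 b) (lift ord0 a))))).
move=> u x; rewrite /= /material /along /sd !sum3.
repeat match goal with |- context [pd ?al ?f ?x] => generalize (pd al f x); intro end.
by move: (velocity u e1 x) (velocity u e2 x) (velocity u e3 x) => *; ring.
Qed.

Lemma linear_eq L L' : (forall u x, L u x = L' u x) ->
  at_most_linear L -> at_most_linear L'.
Proof. by move=> LL' [a0 [a LE]]; exists a0, a => u x; rewrite -LL' LE. Qed.

Lemma linear_coefficient k : coefficient k -> at_most_linear k.
Proof.
move=> [k0 kE]; exists k0, (fun _ _ _ => 0) => u x.
rewrite kE big1 ?addr0// => A _; rewrite big1// => al _; exact: mul0r.
Qed.

Lemma linear_pd A al : at_most_linear (fun u : fluid R => pd al (unknown_field u A)).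
Proof.
exists (fun=> 0), (fun A' al' _ => (A' == A)%:R * (al' == al)%:R) => u x.
under eq_bigr => A' _ do under eq_bigr => al' _ do rewrite -mulrA.
under eq_bigr => A' _ do rewrite -mulr_sumr sum_indicator.
by rewrite sum_indicator add0r.
Qed.

Lemma linearD L L' : at_most_linear L -> at_most_linear L' ->
  at_most_linear (fun u x => L u x + L' u x).
Proof.
move=> [a0 [a LE]] [b0 [b LE']].
exists (fun w => a0 w + b0 w), (fun A al w => a A al w + b A al w) => u x.
rewrite LE LE' addrACA; congr (_ + _).
rewrite -big_split; apply: eq_bigr => A _.
by rewrite -big_split; apply: eq_bigr => al _; rewrite /= mulrDl.
Qed.

Lemma linearM k L : coefficient k -> at_most_linear L ->
  at_most_linear (fun u x => k u x * L u x).
Proof.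
move=> [k0 kE] [a0 [a LE]].
exists (fun w => k0 w * a0 w), (fun A al w => k0 w * a A al w) => u x.
rewrite kE LE mulrDr; congr (_ + _); rewrite !mulr_sumr; apply: eq_bigr => A _.
by rewrite mulr_sumr; apply: eq_bigr => al _; rewrite mulrA.
Qed.

Lemma linearMr k L : coefficient k -> at_most_linear L ->
  at_most_linear (fun u x => L u x * k u x).
Proof.
move=> ck lL; apply: linear_eq (linearM ck lL) => u x; exact: mulrC.
Qed.

Lemma linearN L : at_most_linear L -> at_most_linear (fun u x => - L u x).
Proof.
move=> lL; apply: linear_eq (linearM (coefficient_cst (-1)) lL) => u x.
exact: mulN1r.
Qed.

Lemma linear_sum (F : 'I_3 -> field) : (forall i, at_most_linear (F i)) ->
  at_most_linear (fun u x => \sum_i F i u x).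
Proof.
move=> lF; apply: linear_eq (linearD (linearD (lF e1) (lF e2)) (lF e3)).
by move=> u x; rewrite sum3.
Qed.

Lemma linear_material A : at_most_linear (fun u : fluid R => material u (unknown_field u A)).
Proof.
apply: linearD; first exact: linear_pd.
apply: linear_sum => a; apply: linearM; last exact: linear_pd.
exact: (coefficient_unknown (U_v a)).
Qed.

(** Both tactics recurse on the expression.  In a product, the factor that is a function
of the undifferentiated unknowns may be on either side. *)
Ltac prove_coefficient := lazymatch goal with
  | |- coefficient (fun u x => @?k u x + @?l u x) =>
      apply: (@coefficientD k l); prove_coefficient
  | |- coefficient (fun u x => @?k u x * @?l u x) =>
      apply: (@coefficientM k l); prove_coefficient
  | |- coefficient (fun u x => - @?k u x) =>
      apply: (@coefficient_comp (@GRing.opp R) k); prove_coefficient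
  | |- coefficient (fun u x => (@?k u x)^-1) =>
      apply: (@coefficient_comp (@GRing.inv R) k); prove_coefficient
  | |- coefficient (fun u x => @?k u x ^+ ?n) =>
      apply: (@coefficient_comp (fun r => r ^+ n) k); prove_coefficient
  | |- coefficient (fun u x => expR (@?k u x)) =>
      apply: (@coefficient_comp (@expR R) k); prove_coefficient
  | |- coefficient (fun u x => log_density u x) =>
      exact: (coefficient_unknown U_rho)
  | |- coefficient (fun u x => egrad u ?i x) =>
      exact: (coefficient_unknown (U_S i))
  | |- coefficient (fun u x => Omega u ?i x) =>
      exact: (coefficient_unknown (U_Omega i))
  | |- coefficient (fun u x => csp _ _ u x) => exact: coefficient_state
  | |- coefficient (fun u x => csp_rho _ _ u x) => exact: coefficient_state
  | |- coefficient (fun u x => csp_s _ _ u x) => exact: coefficient_state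
  | |- coefficient (fun u x => p_s _ _ u x) => exact: coefficient_state
  | |- coefficient (fun u x => p_rho_s _ _ u x) => exact: coefficient_state
  | |- coefficient (fun u x => p_s_rho _ _ u x) => exact: coefficient_state
  | |- coefficient (fun u x => p_s_s _ _ u x) => exact: coefficient_state
  | |- _ => first [ exact: coefficient_cst
                  | refine (coefficient_sum _); intro; prove_coefficient ]
  end.

Ltac prove_linear := lazymatch goal with
  | |- at_most_linear (fun u x => @?k u x + @?l u x) =>
      apply: (@linearD k l); prove_linear
  | |- at_most_linear (fun u x => - @?k u x) =>
      apply: (@linearN k); prove_linear
  | |- at_most_linear (fun u x => @?k u x * @?l u x) =>
      first [ refine (@linearM k l _ _); [solve [prove_coefficient] | prove_linear]
            | refine (@linearMr l k _ _); [solve [prove_coefficient] | prove_linear] ]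
  | |- at_most_linear (fun u x => material u (log_density u) x) =>
      exact: (linear_material U_rho)
  | |- at_most_linear (fun u x => material u (velocity u ?i) x) =>
      exact: (linear_material (U_v i))
  | |- at_most_linear (fun u x => sd ?a (log_density u) x) =>
      exact: (linear_pd U_rho (lift ord0 a))
  | |- at_most_linear (fun u x => sd ?a (velocity u ?i) x) =>
      exact: (linear_pd (U_v i) (lift ord0 a))
  | |- _ => first [ refine (linear_coefficient _); solve [prove_coefficient]
                  | refine (linear_sum _); intro; prove_linear ]
  end.

Lemma L_v_linear i : at_most_linear (fun u => L_v rhobar p u i).
Proof. rewrite /L_v /cross /along /=. prove_linear. Qed.

Lemma L_rho_linear : at_most_linear (fun u => L_rho rhobar p u).
Proof. rewrite /L_rho /dot /along /=. prove_linear. Qed.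

Lemma L_Omega_linear i : at_most_linear (fun u => L_Omega rhobar p u i).
Proof. rewrite /L_Omega /cross /along /=. prove_linear. Qed.

Lemma L_S_linear i : at_most_linear (fun u : fluid R => L_S u i).
Proof. rewrite /L_S /cross /along /=. prove_linear. Qed.

Lemma L_divOmega_linear : at_most_linear (fun u : fluid R => L_divOmega u).
Proof. rewrite /L_divOmega /along /=. prove_linear. Qed.

Lemma L_C_linear i : at_most_linear (fun u => L_C rhobar p u i).
Proof. rewrite /L_C /dot /=. prove_linear. Qed.

Lemma Q_v_null i : null_form rhobar p (fun u => Q_v rhobar p u i).
Proof.
apply: (null_formM (k := fun u x => - (1 + (csp rhobar p u x)^-1 * csp_rho rhobar p u x))).
  prove_coefficient.
exact: (null_form_ginv U_rho (U_v i)).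
Qed.

(** The four null forms of which the quadratic terms in Q_rho, Q_C and Q_D are built,
written as sums of antisymmetrized products; the lemmas with suffix E give them as
they occur in the equations. *)
Definition div_form (u : fluid R) x : R := \sum_a \sum_b
  (sd a (velocity u a) x * sd b (velocity u b) x
   - sd a (velocity u b) x * sd b (velocity u a) x).

Lemma div_form_null : null_form rhobar p div_form.
Proof.
do 2 (apply: null_form_sum => ?).
exact: (null_form_wedge (U_v _) (U_v _) (lift ord0 _) (lift ord0 _)).
Qed.

Lemma div_formE u x : div_form u x =
  divg (velocity u) x * divg (velocity u) x
  - \sum_a \sum_b sd a (velocity u b) x * sd b (velocity u a) x.
Proof.
rewrite /div_form; under eq_bigr do rewrite sumrB -mulr_sumr.
by rewrite sumrB -mulr_suml.
Qed.

Definition stretch_form A (u : fluid R) x : R := \sum_a \sum_b egrad u a x *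
  (sd b (velocity u b) x * sd a (unknown_field u A) x
   - sd b (unknown_field u A) x * sd a (velocity u b) x).

Lemma stretch_form_null A : null_form rhobar p (stretch_form A).
Proof.
apply: null_form_sum => a; apply: null_form_sum => b.
apply: null_formM; first exact: (coefficient_unknown (U_S a)).
exact: (null_form_wedge (U_v b) A (lift ord0 b) (lift ord0 a)).
Qed.

Lemma stretch_formE A u x : stretch_form A u x =
  divg (velocity u) x * along (egrad u) (unknown_field u A) x
  - \sum_a \sum_b egrad u a x * sd a (velocity u b) x * sd b (unknown_field u A) x.
Proof.
rewrite /stretch_form /along mulr_sumr -sumrB; apply: eq_bigr => a _.
rewrite -mulr_sumr sumrB -mulr_suml mulrBr mulrCA; congr (_ - _).
by rewrite mulr_sumr; apply: eq_bigr => b _; rewrite -mulrA [sd a _ _ * _]mulrC.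
Qed.

Definition entropy_transport_form i (u : fluid R) x : R := \sum_a egrad u a x *
  (material u (velocity u i) x * sd a (log_density u) x
   - material u (log_density u) x * sd a (velocity u i) x).

Lemma entropy_transport_form_null i : null_form rhobar p (entropy_transport_form i).
Proof.
apply: null_form_sum => a.
apply: null_formM; first exact: (coefficient_unknown (U_S a)).
exact: (null_form_material (U_v i) U_rho a).
Qed.

Lemma entropy_transport_formE i u x : entropy_transport_form i u x =
  along (egrad u) (log_density u) x * material u (velocity u i) x
  - material u (log_density u) x * along (egrad u) (velocity u i) x.
Proof.
rewrite /along mulr_suml mulr_sumr -sumrB; apply: eq_bigr => a _.
by rewrite mulrBr; congr (_ - _); [rewrite -mulrA [sd a _ _ * _]mulrC|rewrite mulrCA].
Qed.

Definition density_transport_form (u : fluid R) x : R := \sum_a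
  (material u (velocity u a) x * sd a (log_density u) x
   - material u (log_density u) x * sd a (velocity u a) x).

Lemma density_transport_form_null : null_form rhobar p density_transport_form.
Proof. by apply: null_form_sum => a; exact: (null_form_material (U_v a) U_rho a). Qed.

Lemma density_transport_formE u x : density_transport_form u x =
  (\sum_a material u (velocity u a) x * sd a (log_density u) x)
  - divg (velocity u) x * material u (log_density u) x.
Proof. by rewrite /density_transport_form sumrB -mulr_sumr mulrC. Qed.

Lemma Q_rho_null : null_form rhobar p (fun u => Q_rho rhobar p u).
Proof.
apply: (null_form_eq (Q := fun u x =>
  - (3 * (csp rhobar p u x)^-1 * csp_rho rhobar p u x) *
    ginv_form rhobar p u (log_density u) (log_density u) x + div_form u x)).
  by move=> u x; rewrite div_formE /Q_rho mulNr.
apply: null_formD div_form_null; apply: null_formM; first prove_coefficient.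
exact: (null_form_ginv U_rho U_rho).
Qed.

(** The eight terms of Q_C are grouped by the null form that they multiply; the last two
groups have the opposite coefficients M and - M, up to the factor S^i. *)
Lemma Q_C_null i : null_form rhobar p (fun u => Q_C rhobar p u i).
Proof.
pose K u x := expR (- (3 * log_density u x)) * (csp rhobar p u x)^- 2.
pose Kq u x := K u x * (p_s rhobar p u x / rhobar).
pose M u x := 2 * Kq u x + 2 * expR (- (3 * log_density u x)) *
  (csp rhobar p u x)^- 3 * csp_rho rhobar p u x * (p_s rhobar p u x / rhobar)
  - K u x * (p_s_rho rhobar p u x / rhobar).
apply: (null_form_eq (Q := fun u x => - (Kq u x * egrad u i x) * div_form u x
  + Kq u x * stretch_form (U_v i) u x + M u x * entropy_transport_form i u x
  + - (M u x * egrad u i x) * density_transport_form u x)).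
  move=> u x; rewrite div_formE stretch_formE entropy_transport_formE.
  rewrite density_transport_formE /M /Kq /K /Q_C.
  move=> /=; move: (divg _ x) (along _ _ x) (along _ _ x) (material _ _ x) (material _ _ x).
  move: (\sum_a _) (\sum_a _) (\sum_a _) (egrad _ _ _).
  move: (csp _ _ _ _) (csp_rho _ _ _ _) (p_s _ _ _ _) (p_s_rho _ _ _ _) (expR _).
  by move=> *; ring.
do ?apply: null_formD; apply: null_formM; rewrite ?/M ?/Kq ?/K; try solve [prove_coefficient].
- exact: div_form_null.
- exact: stretch_form_null.
- exact: entropy_transport_form_null.
- exact: density_transport_form_null.
Qed.

Lemma Q_D_null : null_form rhobar p (fun u : fluid R => Q_D u).
Proof.
apply: (null_form_eq (Q := fun u x =>
    - (2 * expR (- (2 * log_density u x))) * stretch_form U_rho u x)).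
  by move=> u x; rewrite stretch_formE /Q_D mulNr -mulrN opprB.
by apply: null_formM (stretch_form_null _); prove_coefficient.
Qed.

End null_and_linear_forms.

(** * The equations *)

Unset Implicit Arguments.

Theorem theorem3p1 (R : realType) (rhobar : R) (p : R * R -> R)
    (rhobar_gt0 : 0 < rhobar)
    (p_smooth : smooth_on [set z : R * R | 0 < z.1] p)
    (c_gt0 : forall z : R * R, 0 < sound_speed rhobar p z) :
  (forall i : 'I_3,
    [/\ null_form rhobar p (fun u : fluid R => Q_v rhobar p u i),
        null_form rhobar p (fun u : fluid R => Q_rho rhobar p u),
        null_form rhobar p (fun u : fluid R => Q_C rhobar p u i)
      & null_form rhobar p (fun u : fluid R => Q_D u)]) /\
  (forall i : 'I_3,
    [/\ at_most_linear (fun u : fluid R => L_v rhobar p u i),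
        at_most_linear (fun u : fluid R => L_rho rhobar p u),
        at_most_linear (fun u : fluid R => L_Omega rhobar p u i)
      & [/\ at_most_linear (fun u : fluid R => L_S u i),
            at_most_linear (fun u : fluid R => L_divOmega u)
          & at_most_linear (fun u : fluid R => L_C rhobar p u i)]]) /\
  forall (U : set (spacetime R)) (u : fluid R),
    let rho := log_density u in
    let v := velocity u in
    let s := entropy u in
    let q := fun x => p_s rhobar p u x / rhobar in
    let c := csp rhobar p u in
    let box := box rhobar p u in
    let B := material u in
    let Omega := Omega u in
    let S := egrad u in
    let C := mod_vort rhobar p u in
    let D := mod_ent u in
    open U ->
    smooth_on U rho -> (forall i, smooth_on U (v i)) -> smooth_on U s ->
    (forall x, U x -> euler_at rhobar p u x) ->
    forall (x : spacetime R) (i : 'I_3), U x ->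
    [/\ (* covariant wave equations *)
        box (v i) x = - (c x) ^+ 2 * expR (2 * rho x) * C i x
                      + Q_v rhobar p u i x + L_v rhobar p u i x
      /\ box rho x = - expR (rho x) * q x * D x
                     + Q_rho rhobar p u x + L_rho rhobar p u x,
        (* transport equations *)
        [/\ B (Omega i) x = L_Omega rhobar p u i x,
            B s x = 0
          & B (S i) x = L_S u i x],
        (* specific vorticity *)
        divg Omega x = L_divOmega u x
      /\ B (C i) x =
           - 2 * (\sum_j \sum_a \sum_b levi_civita R i a b * expR (- rho x) *
                    sd a (v j) x * sd b (Omega j) x)
           + (\sum_a \sum_j \sum_k levi_civita R a j k * expR (- rho x) *
                sd a (v i) x * sd j (Omega k) x)
           + expR (- (3 * rho x)) * (c x)^- 2 * q x *
               ((\sum_a B (S a) x * sd a (v i) x) - B (v i) x * divg S x)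
           + expR (- (3 * rho x)) * (c x)^- 2 * q x *
               ((\sum_a B (v a) x * sd a (S i) x) - divg v x * B (S i) x)
           + Q_C rhobar p u i x + L_C rhobar p u i x
      & (* entropy gradient *)
        B D x = 2 * expR (- (2 * rho x)) *
                  (divg v x * divg S x - \sum_a \sum_b sd a (v b) x * sd b (S a) x)
                + expR (- rho x) * dot (fun a => curl Omega a x) (fun a => S a x)
                + Q_D u x
      /\ curl S i x = 0].
Proof.
split; first by move=> i; split;
  [exact: Q_v_null|exact: Q_rho_null|exact: Q_C_null|exact: Q_D_null].
split.
  move=> i; split; [exact: L_v_linear|exact: L_rho_linear|exact: L_Omega_linear|].
  by split; [exact: L_S_linear|exact: L_divOmega_linear|exact: L_C_linear].
move=> U u rho v s q c box B Omega S C D oU srho sv ss euler x i Ux; split.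
- split.
    exact: (box_v rhobar_gt0 p_smooth c_gt0 oU srho sv ss euler).
  exact: (box_rho rhobar_gt0 p_smooth c_gt0 oU srho sv ss euler).
- split.
  + have := Dt_Omega rhobar_gt0 p_smooth c_gt0 oU srho sv ss euler i Ux.
    by rewrite -DtE -OmE.
  + by case: (euler x Ux).
  + have := Dt_egrad oU sv ss euler i Ux.
    by rewrite -DtE.
- split.
    have := divg_Omega oU srho sv Ux.
    by rewrite -OmE.
  have := Dt_mod_vort rhobar_gt0 p_smooth c_gt0 oU srho sv ss euler i Ux.
  by rewrite -DtE -DxE -OmE -(expRNn _ 3).
- split; last exact: (curl_egrad oU ss i Ux).
  have := Dt_mod_ent oU srho sv ss euler Ux.
  by rewrite -DtE -DxE -OmE -(expRNn _ 2).
Qed.
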